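(* There exists a constant non-zero vector $v=(v_g)_{g\in G}\in\mathbb{C}^{|G|}$ (that is, $v$ is not the zero vector, and it does not depend on $x$, $y$ or $\delta$) such that for each $\delta>0$ and each $g\in G$, $$\lim_{\substack{|x|\,|y|\to+\infty\\ x,y\in C_\delta}}\sqrt{w_k(x)\,w_k(y)}\;e^{-i\langle x,gy\rangle}\,E_k(ix,gy)=v_g,$$ i.e. for every $\varepsilon>0$ there is $M>0$ such that $\big|\sqrt{w_k(x)w_k(y)}\,e^{-i\langle x,gy\rangle}E_k(ix,gy)-v_g\big|<\varepsilon$ for all $x,y\in C_\delta$ with $|x|\,|y|\ge M$.
   Context: Let $R$ be a reduced root system in $\mathbb{R}^n$ spanning $\mathbb{R}^n$, $R^+$ a positive subsystem, $\Delta=\{\alpha_1,\dots,\alpha_n\}$ the corresponding simple roots, and $G\subset O(\mathbb{R}^n)$ the finite reflection group generated by the reflections $\sigma_\alpha$, $\alpha\in R$, where $\sigma_\alpha$ is the orthogonal reflection in the hyperplane orthogonal to $\alpha$. $\langle\cdot,\cdot\rangle$ is the Euclidean inner product (extended bilinearly to $\mathbb{C}^n$) and $|\cdot|$ its norm. The open fundamental Weyl chamber is $C=\{\sum_{i=1}^n x_i\lambda_i:\ x_i>0 \ \forall i\}$ where $(\lambda_i)$ is the dual basis of $\Delta$ ($\langle\lambda_i,\alpha_j\rangle=\delta_{ij}$); equivalently $C=\{x:\langle x,\alpha\rangle>0\ \forall\alpha\in R^+\}$. For $\delta>0$, $$C_\delta=\{x\in C:\ \langle x,\alpha\rangle\ge\delta|x|\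 \text{ for all }\alpha\in R^+\}.$$ Let $k:R\to[0,+\infty)$ be a $G$-invariant function (multiplicity function), and $\gamma_k=\sum_{\alpha\in R^+}k(\alpha)$, assumed $>0$. The weight is $w_k(x)=\prod_{\alpha\in R^+}|\langle\alpha,x\rangle|^{2k(\alpha)}$. The Dunkl operators are, for $\xi\in\mathbb{R}^n$, $$D_\xi^kf(x)=\partial_\xi f(x)+\sum_{\alpha\in R^+}k(\alpha)\langle\alpha,\xi\rangle\frac{f(x)-f(\sigma_\alpha x)}{\langle\alpha,x\rangle}.$$ For $y\in\mathbb{C}^n$, the Dunkl kernel $x\mapsto E_k(x,y)$ is the unique real-analytic solution on $\mathbb{R}^n$ of $D_\xi^kf=\langle y,\xi\rangle f$ for all $\xi\in\mathbb{R}^n$ with $f(0)=1$; $E_k$ extends to a holomorphic function on $\mathbb{C}^n\times\mathbb{C}^n$. *)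

(* Defs.v *)
From HB Require Import structures.
From mathcomp Require Import all_boot all_order all_algebra finmap complex.
From mathcomp Require Import all_classical all_reals all_analysis.

Set Implicit Arguments.
Unset Strict Implicit.
Unset Printing Implicit Defensive.

Import Order.TTheory GRing.Theory Num.Theory.
Import numFieldNormedType.Exports.

Local Open Scope classical_set_scope.
Local Open Scope ring_scope.
Local Open Scope complex_scope.

(* Bilinear, not sesquilinear: over [R[i]] this is the bilinear extension of
   the Euclidean inner product. *)
Definition dotp (K : comNzRingType) (n : nat) (u v : 'cV[K]_n) : K :=
  \sum_(i < n) u i 0 * v i 0.

(* The library norm [`|x|] of a matrix is the sup norm. *)
Definition enorm (R : rcfType) (n : nat) (x : 'cV[R]_n) : R :=
  Num.sqrt (dotp x x).

Definition toC (R : rcfType) (n : nat) (x : 'cV[R]_n) : 'cV[R[i]]_n :=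
  map_mx (real_complex R) x.

(* exp (i t) for real t *)
Definition cexpi (R : realType) (t : R) : R[i] := cos t +i* sin t.

(* x |-> x - 2 <a, x> / <a, a> a *)
Definition reflmx (R : rcfType) (n : nat) (a : 'cV[R]_n) : 'M[R]_n :=
  1%:M - (2 / dotp a a) *: (a *m a^T).

(* As usual for Dunkl operators, no crystallographic condition is imposed. *)
Record reduced_root_system (R : realType) (n : nat) (Rt : {fset 'cV[R]_n}) :
    Prop := ReducedRootSystem {
  root_neq0 : 0 \notin Rt ;
  root_span : (<<Rt>> = fullv)%VS ;
  root_refl : forall a b, a \in Rt -> b \in Rt -> reflmx a *m b \in Rt ;
  root_reduced : forall a (c : R), a \in Rt -> c *: a \in Rt ->
    c = 1 \/ c = -1 }.

Definition positive_subsystem (R : realType) (n : nat)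
    (Rt Rp : {fset 'cV[R]_n}) : Prop :=
  exists2 b : 'cV[R]_n, (forall a, a \in Rt -> dotp a b != 0) &
    forall a, (a \in Rp) = (a \in Rt) && (0 < dotp a b).

Inductive reflection_group (R : realType) (n : nat) (Rt : {fset 'cV[R]_n}) :
    'M[R]_n -> Prop :=
| RG_refl a : a \in Rt -> reflection_group Rt (reflmx a)
| RG_one : reflection_group Rt 1%:M
| RG_mul g h : reflection_group Rt g -> reflection_group Rt h ->
    reflection_group Rt (g *m h)
| RG_inv g : reflection_group Rt g -> reflection_group Rt (invmx g).

(* Only the values of [k] on [Rt] are meaningful. *)
Record multiplicity (R : realType) (n : nat) (Rt : {fset 'cV[R]_n})
    (k : 'cV[R]_n -> R) : Prop := Multiplicity {
  mult_ge0 : forall a, a \in Rt -> 0 <= k a ;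
  mult_inv : forall g a, reflection_group Rt g -> a \in Rt ->
    k (g *m a) = k a }.

Definition weyl_chamber (R : realType) (n : nat) (Rp : {fset 'cV[R]_n}) :
    set 'cV[R]_n :=
  [set x | forall a, a \in Rp -> 0 < dotp x a].

Definition weyl_chamber_delta (R : realType) (n : nat) (Rp : {fset 'cV[R]_n})
    (delta : R) : set 'cV[R]_n :=
  [set x | weyl_chamber Rp x /\
           forall a, a \in Rp -> delta * enorm x <= dotp x a].

Definition dunkl_weight (R : realType) (n : nat) (Rp : {fset 'cV[R]_n})
    (k : 'cV[R]_n -> R) (x : 'cV[R]_n) : R :=
  \prod_(a <- Rp) `|dotp a x| `^ (2 * k a).

Definition rderive (R : realType) (n : nat) (xi : 'cV[R]_n)
    (f : 'cV[R]_n -> R[i]) (x : 'cV[R]_n) : R[i] :=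
  'D_xi (fun z => complex.Re (f z)) x +i* 'D_xi (fun z => complex.Im (f z)) x.

(* (f x - f (sigma_a x)) / <a, x>; for f of class C^1 this extends continuously
   across the hyperplane orthogonal to a, where the value is the one below. *)
Definition dunkl_quotient (R : realType) (n : nat) (a : 'cV[R]_n)
    (f : 'cV[R]_n -> R[i]) (x : 'cV[R]_n) : R[i] :=
  if dotp a x == 0 then (2 / dotp a a)%:C * rderive a f x
  else (f x - f (reflmx a *m x)) / (dotp a x)%:C.

Definition dunkl_operator (R : realType) (n : nat) (Rp : {fset 'cV[R]_n})
    (k : 'cV[R]_n -> R) (xi : 'cV[R]_n) (f : 'cV[R]_n -> R[i])
    (x : 'cV[R]_n) : R[i] :=
  rderive xi f x +
  \sum_(a <- Rp) (k a * dotp a xi)%:C * dunkl_quotient a f x.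

(* Differentiability over [K]: joint holomorphy when [K] is [R[i]].  It is stated
   for an abstract field because the library puts a topology on such a [K] but
   not on [R[i]] itself; the instantiation gives [R[i]] that of [R[i]^o]. *)
Definition jointly_differentiable (K : numFieldType) (n : nat)
    (E : 'cV[K]_n -> 'cV[K]_n -> K) : Prop :=
  forall p : 'cV[K]_n * 'cV[K]_n, differentiable (fun q => E q.1 q.2) p.

(* [E] is the Dunkl kernel, extended to C^n x C^n.  Joint holomorphy makes each
   x |-> E (x, y) real-analytic on R^n, so that these conditions determine E
   on R^n x C^n, and hence on C^n x C^n. *)
Record is_dunkl_kernel (R : realType) (n : nat) (Rp : {fset 'cV[R]_n})
    (k : 'cV[R]_n -> R) (E : 'cV[R[i]]_n -> 'cV[R[i]]_n -> R[i]) : Prop :=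
  IsDunklKernel {
  dunkl_kernel_holomorphic : jointly_differentiable E ;
  dunkl_kernel_eigen : forall (y : 'cV[R[i]]_n) (xi x : 'cV[R]_n),
    dunkl_operator Rp k xi (fun z => E (toC z) y) x =
      dotp y (toC xi) * E (toC x) y ;
  dunkl_kernel_0 : forall y : 'cV[R[i]]_n, E 0 y = 1 }.

(* Main.v *)
Require Import Defs.
From mathcomp Require Import all_boot all_order all_algebra finmap complex.
From mathcomp Require Import all_classical all_reals all_analysis.
From mathcomp Require Import ring lra.

Set Implicit Arguments.
Unset Strict Implicit.
Unset Printing Implicit Defensive.

Import Order.TTheory GRing.Theory Num.Theory.
Import numFieldNormedType.Exports.

Local Open Scope classical_set_scope.
Local Open Scope ring_scope.
Local Open Scope complex_scope.

(** Write [Phi x y = E (x, i y)] for real [x, y].  The eigenvalue equations contracted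
    with [x] give an equation along rays, t f' = t lam f - sum k_a (f - f o sigma_a),
    with a regular singular point at t = 0 ([euler_solution]).  Summed over the group,
    the reflection terms are dissipative, so the orbit energy sum_g |f (t g x)|^2 obeys a
    Gronwall inequality ([denergy_bounds]).  Hence a solution is determined by its value
    at 0 ([euler_unique]), it is bounded when the spectral parameter is imaginary, and its
    values on an orbit never vanish simultaneously ([energy_pos]).

    Dilations and group elements act on solutions, so uniqueness gives
    E (c x, y) = E (x, c y) for real c, Phi (g x, g y) = Phi (x, y), and then
    Phi (x, y) = Phi (y, x), because in [y] the function Phi (x, y) solves the equation of
    Phi (y, x) ([osc_sym]).  The theorem speaks of E (i x, g y) and the equations of
    E (x, i g y); that the two agree is the identity theorem for entire functions
    ([entire_eq0_at_i]).  It rests on Goursat's lemma, since holomorphy means here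
    complex differentiability only.

    On the chamber, the functions
    F_g (x, y) = sqrt (w (x) w (y)) exp (- i <x, g y>) Phi (x, g y) satisfy a linear system
    whose coefficients are oscillating, of size 1/|x|, and couple g to sigma_a g only
    ([cder_amplitude]).  Subtracting a small oscillating multiple of F_(sigma_a g)
    integrates these terms by parts: the corrected functions have derivatives of size
    1/(|x|^2 |y|) ([cder_corrected]).  So they are bounded and bounded away from 0 along
    rays ([l2_corrected_ray]), and F_g varies by O(1/(|x| |y|)) when x moves in C_delta
    ([amplitude_dist_left]).  By symmetry the same holds when y moves, so F_g is Cauchy as
    |x| |y| tends to infinity ([amplitude_dist]); its limit depends on g only, and the
    lower bound along rays makes some component of the limit non-zero. *)

(** * Real and complex numbers *)

Lemma eq_ler (R : realType) (x y : R) : x = y -> x <= y.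
Proof. by move->. Qed.

Lemma sum_const_seq (R : pzRingType) (I : Type) (s : seq I) (c : R) :
  \sum_(i <- s) c = (size s)%:R * c.
Proof. by rewrite big_const_seq count_predT iter_addr_0 mulr_natl. Qed.

Section complex_norm.
Variable R : realType.
Implicit Types z w : R[i].

Definition cabs z : R := Normc.normc z.

Lemma cabsE z : cabs z = Num.sqrt (complex.Re z ^+ 2 + complex.Im z ^+ 2).
Proof. by case: z. Qed.

Lemma norm_cabs z : `|z| = (cabs z)%:C.
Proof. by []. Qed.

Lemma cabs_ge0 z : 0 <= cabs z.
Proof. by rewrite cabsE sqrtr_ge0. Qed.

Lemma cabs_sqr z : cabs z ^+ 2 = complex.Re z ^+ 2 + complex.Im z ^+ 2.
Proof. by rewrite cabsE sqr_sqrtr// addr_ge0// sqr_ge0. Qed.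

Lemma cabsM z w : cabs (z * w) = cabs z * cabs w.
Proof. exact: Normc.normcM. Qed.

Lemma cabsX z n : cabs (z ^+ n) = cabs z ^+ n.
Proof.
elim: n => [|n ih]; first by rewrite !expr0 /cabs Normc.normc1.
by rewrite !exprS cabsM ih.
Qed.

Lemma cabs0 : cabs 0 = 0.
Proof. exact: Normc.normc0. Qed.

Lemma cabs1 : cabs 1 = 1.
Proof. exact: Normc.normc1. Qed.

Lemma cabs_i : cabs 'i%C = 1.
Proof. by rewrite cabsE/= expr0n/= add0r expr1n sqrtr1. Qed.

Lemma cabs_eq0 z : cabs z = 0 -> z = 0.
Proof. exact: Normc.eq0_normc. Qed.

Lemma cabsD z w : cabs (z + w) <= cabs z + cabs w.
Proof. by have := ler_normD z w; rewrite !norm_cabs -rmorphD lecR. Qed.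

Lemma cabsN z : cabs (- z) = cabs z.
Proof. by have := normrN z; rewrite !norm_cabs => /complexI. Qed.

Lemma cabsB z w : cabs (z - w) <= cabs z + cabs w.
Proof. by rewrite -(cabsN w) cabsD. Qed.

Lemma cabs_dist z w : cabs (z - w) = cabs (w - z).
Proof. by rewrite -cabsN opprB. Qed.

Lemma cabs_sum (I : Type) (s : seq I) (P : pred I) (f : I -> R[i]) :
  cabs (\sum_(i <- s | P i) f i) <= \sum_(i <- s | P i) cabs (f i).
Proof.
elim/big_rec2: _ => [|i x y _ h]; first by rewrite cabs0.
by rewrite (le_trans (cabsD _ _))// lerD2l.
Qed.

Lemma cabs_real (x : R) : cabs x%:C = `|x|.
Proof. by rewrite cabsE/= expr0n/= addr0 sqrtr_sqr. Qed.

Lemma normRe_cabs z : `|complex.Re z| <= cabs z.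
Proof. by have := normc_ge_Re z; rewrite norm_cabs lecR. Qed.

Lemma normIm_cabs z : `|complex.Im z| <= cabs z.
Proof. by rewrite cabsE -sqrtr_sqr ler_sqrt ?lerDr ?addr_ge0 ?sqr_ge0. Qed.

Lemma cabs_ReIm z : cabs z <= `|complex.Re z| + `|complex.Im z|.
Proof.
rewrite -[leRHS]ger0_norm ?addr_ge0// -sqrtr_sqr cabsE.
rewrite ler_sqrt ?sqr_ge0// sqrrD !real_normK ?num_real//.
by rewrite addrAC lerDl mulrn_wge0// mulr_ge0.
Qed.

Lemma ltc_cabs z (e : R) : (`|z| < e%:C) = (cabs z < e).
Proof. by rewrite norm_cabs ltcR. Qed.

Lemma cabs_cexpi (t : R) : cabs (cexpi t) = 1.
Proof. by rewrite cabsE/= cos2Dsin2 sqrtr1. Qed.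

Lemma cexpiD (s t : R) : cexpi (s + t) = cexpi s * cexpi t.
Proof.
rewrite /cexpi cosD sinD; apply/eqP.
by rewrite eq_complex/= addrC (addrC (sin s * _)) mulrC !eqxx.
Qed.

Lemma RecM z w : complex.Re (z * w) =
  complex.Re z * complex.Re w - complex.Im z * complex.Im w.
Proof. by case: z => a b; case: w. Qed.

Lemma ImcM z w : complex.Im (z * w) =
  complex.Re z * complex.Im w + complex.Im z * complex.Re w.
Proof. by case: z => a b; case: w. Qed.

Lemma RecD z w : complex.Re (z + w) = complex.Re z + complex.Re w.
Proof. by case: z => a b; case: w. Qed.

Lemma ImcD z w : complex.Im (z + w) = complex.Im z + complex.Im w.
Proof. by case: z => a b; case: w. Qed.

Lemma RecN z : complex.Re (- z) = - complex.Re z.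
Proof. by case: z. Qed.

Lemma ImcN z : complex.Im (- z) = - complex.Im z.
Proof. by case: z. Qed.

Lemma complex_eq z w : complex.Re z = complex.Re w ->
  complex.Im z = complex.Im w -> z = w.
Proof. by case: z => a b; case: w => c d /= -> ->. Qed.

End complex_norm.

(** * Calculus along the real line *)

Lemma derivable_eps (K : numFieldType) (V : normedModType K) (f : V -> K^o)
    (p v : V) : derivable f p v ->
  forall e : K, 0 < e -> exists2 r : K, 0 < r &
    forall h : K, `|h| < r -> `|f (h *: v + p) - f p - h * 'D_v f p| <= e * `|h|.
Proof.
move=> hd e e0; set d := 'D_v f p.
have /cvgrPdist_le/(_ _ e0) : h^-1 *: ((f \o shift p) (h *: v) - f p) @[h --> 0^'] --> d by [].
move=> -[r /= r0 hr]; exists r => // h hh.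
have [->|h0] := eqVneq h 0; first by rewrite scale0r add0r subrr mul0r subrr !normr0 mulr0.
have /= := hr h; rewrite /ball_ /= sub0r normrN => /(_ hh h0).
move=> H.
have -> : f (h *: v + p) - f p - h * d = - (h * (d - h^-1 *: (f (h *: v + p) - f p))).
  by rewrite mulrBr opprB; congr (_ - _); apply/esym; exact: (scalerKV h0).
by rewrite normrN normrM mulrC ler_wpM2r.
Qed.

Lemma is_derive_linear (R : realType) (c t : R) :
  is_derive t 1 (fun y => c * y : R^o) c.
Proof.
apply: is_derive_eq (is_deriveM (is_derive_cst (c : R^o) t 1) (is_derive_id t 1)) _.
by rewrite /GRing.scale/=; ring.
Qed.

Section complex_valued_derivative.
Variable R : realType.
Implicit Types (f g : R -> R[i]) (t : R) (a b : R[i]).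

Lemma is_derive_eps (V : normedModType R) (f : V -> R) (p v : V) d :
  (forall e : R, 0 < e -> exists2 r : R, 0 < r &
    forall h, `|h| < r -> `|f (p + h *: v) - f p - h * d| <= e * `|h|) ->
  is_derive p v (f : V -> R^o) d.
Proof.
move=> hf.
have cv : h^-1 *: ((f \o shift p) (h *: v) - f p) @[h --> 0^'] --> (d : R^o).
  apply/cvgrPdist_le => e e0; have [r r0 hr] := hf e e0.
  exists r => //= h /=; rewrite /ball_ /= sub0r normrN => hh h0.
  rewrite -normrN opprB.
  have -> : h^-1 *: (f (h *: v + p) - f p) - d = (f (p + h *: v) - f p - h * d) / h.
    by rewrite /GRing.scale/= (addrC p) [in RHS]mulrBl mulrC [h * d]mulrC mulfK.
  by rewrite normrM normfV ler_pdivrMr ?normr_gt0// hr.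
by apply: DeriveDef; [apply/cvg_ex; exists d|apply: cvg_lim].
Qed.

Lemma is_derive_epsP (f : R -> R) t d : is_derive t 1 (f : R -> R^o) d ->
  forall e : R, 0 < e -> exists2 r : R, 0 < r &
    forall h, `|h| < r -> `|f (t + h) - f t - h * d| <= e * `|h|.
Proof.
move=> hd e e0; have [r r0 hr] := derivable_eps (@ex_derive _ _ _ _ _ _ _ hd) e0.
exists r => // h /hr; rewrite derive_val /GRing.scale/= mulr1 (addrC h t); exact.
Qed.

(** Derivative of a complex-valued function of a real variable, taken on real and
    imaginary parts so that real calculus applies. *)
Definition cder f t a : Prop :=
  is_derive t 1 (fun s => complex.Re (f s) : R^o) (complex.Re a) /\
  is_derive t 1 (fun s => complex.Im (f s) : R^o) (complex.Im a).

Lemma cder_eps f t a :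
  (forall e : R, 0 < e -> exists2 r : R, 0 < r &
    forall h, `|h| < r -> cabs (f (t + h) - f t - h%:C * a) <= e * `|h|) ->
  cder f t a.
Proof.
move=> hf; split; apply: is_derive_eps => e e0; have [r r0 hr] := hf e e0;
  exists r => // h /hr; rewrite [h *: _]mulr1; apply: le_trans.
- by apply: le_trans (normRe_cabs _); rewrite !(RecD, RecN) RecM/= mul0r subr0.
- by apply: le_trans (normIm_cabs _); rewrite !(ImcD, ImcN) ImcM/= mul0r addr0.
Qed.

Lemma cder_eq f t a b : cder f t a -> a = b -> cder f t b.
Proof. by move=> + <-. Qed.

Lemma cder_ext f g t a : cder f t a -> (forall s, f s = g s) -> cder g t a.
Proof. by move=> + fg; have -> : f = g by apply/funext. Qed.

Lemma cder_cst a t : cder (fun=> a) t 0.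
Proof. by split; apply: is_derive_cst. Qed.

Lemma cderD f g t a b :
  cder f t a -> cder g t b -> cder (fun s => f s + g s) t (a + b).
Proof.
move=> [f1 f2] [g1 g2]; split.
- under eq_fun do rewrite RecD; rewrite RecD; exact: is_deriveD.
- under eq_fun do rewrite ImcD; rewrite ImcD; exact: is_deriveD.
Qed.

Lemma cderN f t a : cder f t a -> cder (fun s => - f s) t (- a).
Proof.
move=> [f1 f2]; split.
- under eq_fun do rewrite RecN; rewrite RecN; exact: is_deriveN.
- under eq_fun do rewrite ImcN; rewrite ImcN; exact: is_deriveN.
Qed.

Lemma cderB f g t a b :
  cder f t a -> cder g t b -> cder (fun s => f s - g s) t (a - b).
Proof. by move=> df /cderN; exact: cderD. Qed.

Lemma cderM f g t a b :
  cder f t a -> cder g t b ->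
  cder (fun s => f s * g s) t (a * g t + f t * b).
Proof.
move=> [f1 f2] [g1 g2]; split.
- under eq_fun do rewrite RecM; apply: is_derive_eq.
  rewrite /GRing.scale/= !(RecD, RecM); ring.
- under eq_fun do rewrite ImcM; apply: is_derive_eq.
  rewrite /GRing.scale/= !(ImcD, ImcM); ring.
Qed.

Lemma cder_sum (I : eqType) (s : seq I) (F : I -> R -> R[i]) (D : I -> R[i]) t :
  (forall i, i \in s -> cder (F i) t (D i)) ->
  cder (fun u => \sum_(i <- s) F i u) t (\sum_(i <- s) D i).
Proof.
elim: s => [_|i s ih h].
  by rewrite big_nil; under eq_fun do rewrite big_nil; exact: cder_cst.
rewrite big_cons; under eq_fun do rewrite big_cons.
apply: cderD; first by apply: h; rewrite mem_head.
by apply: ih => j js; apply: h; rewrite inE js orbT.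
Qed.

Lemma cder_real (g : R -> R) t d :
  is_derive t 1 (g : R -> R^o) d -> cder (fun s => (g s)%:C) t d%:C.
Proof. by move=> dg; split => //=; exact: is_derive_cst. Qed.

Lemma cder_cexpi (g : R -> R) t d : is_derive t 1 (g : R -> R^o) d ->
  cder (fun s => cexpi (g s)) t ('i%C * d%:C * cexpi (g t)).
Proof.
move=> dg; split.
- by apply: is_derive_eq (is_derive1_comp (is_derive_cos (g t)) dg) _ => /=; ring.
- by apply: is_derive_eq (is_derive1_comp (is_derive_sin (g t)) dg) _ => /=; ring.
Qed.

Lemma is_derive_cabs_sqr f t a : cder f t a ->
  is_derive t 1 (fun s => cabs (f s) ^+ 2 : R^o)
    (2 * (complex.Re (f t) * complex.Re a + complex.Im (f t) * complex.Im a)).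
Proof.
move=> [f1 f2]; under eq_fun do rewrite cabs_sqr !expr2.
apply: is_derive_eq (is_deriveD (is_deriveM f1 f1) (is_deriveM f2 f2)) _.
by rewrite /GRing.scale/=; ring.
Qed.

(** The sign of the derivative is required in the interior only, where the equations along
    rays hold; at the origin only differentiability is known. *)
Lemma derive_ge0_le (f df : R -> R) (a b : R) : a <= b ->
  (forall t, a <= t <= b -> is_derive t 1 (f : R -> R^o) (df t)) ->
  (forall t, a < t < b -> 0 <= df t) -> f a <= f b.
Proof.
move=> + hd h0; rewrite le_eqVlt => /predU1P[->//|ab]; rewrite -subr_ge0.
have [x|x|c] := @MVT R f df a b ab.
- by rewrite in_itv/= => /andP[ax xb]; apply: hd; rewrite !ltW.
- by move: x; apply: derivable_within_continuous => x; rewrite in_itv/= => /hd h; exact: ex_derive.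
- by rewrite in_itv/= => /h0 dc ->; rewrite mulr_ge0// subr_ge0 ltW.
Qed.

Lemma derive_bound_le (f df g dg : R -> R) (a b : R) : a <= b ->
  (forall t, a <= t <= b -> is_derive t 1 (f : R -> R^o) (df t)) ->
  (forall t, a <= t <= b -> is_derive t 1 (g : R -> R^o) (dg t)) ->
  (forall t, a < t < b -> `|df t| <= dg t) -> `|f b - f a| <= g b - g a.
Proof.
move=> ab hf hg h; rewrite ler_norml; apply/andP; split.
- rewrite -subr_ge0.
  have := @derive_ge0_le (fun t => g t + f t) (fun t => dg t + df t) a b ab _ _.
  move=> /(_ _ _)/= H; suff: g a + f a <= g b + f b by lra.
  apply: H => t tab; first by have := hf _ tab; have := hg _ tab => ? ?; apply: is_deriveD.
  by have := h _ tab; rewrite ler_norml => /andP[]; lra.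
- suff: g a - f a <= g b - f b by lra.
  apply: (@derive_ge0_le (fun t => g t - f t) (fun t => dg t - df t)) => // t tab.
    by have := hf _ tab; have := hg _ tab => ? ?; apply: is_deriveB.
  by have := h _ tab; rewrite ler_norml => /andP[]; lra.
Qed.

Lemma cder_bound_le (f df : R -> R[i]) (g dg : R -> R) (a b : R) : a <= b ->
  (forall t, a <= t <= b -> cder f t (df t)) ->
  (forall t, a <= t <= b -> is_derive t 1 (g : R -> R^o) (dg t)) ->
  (forall t, a < t < b -> cabs (df t) <= dg t) ->
  cabs (f b - f a) <= 2 * (g b - g a).
Proof.
move=> ab hf hg h; apply: (le_trans (cabs_ReIm _)).
rewrite mulr_natl mulr2n !(RecD, RecN, ImcD, ImcN) lerD//.
- apply: (@derive_bound_le (fun t => complex.Re (f t)) (fun t => complex.Re (df t)) g dg) => //.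
  + by move=> t /hf[].
  + by move=> t /h; apply: le_trans; exact: normRe_cabs.
- apply: (@derive_bound_le (fun t => complex.Im (f t)) (fun t => complex.Im (df t)) g dg) => //.
  + by move=> t /hf[].
  + by move=> t /h; apply: le_trans; exact: normIm_cabs.
Qed.

End complex_valued_derivative.

(** The rate [c / s^2] is integrable up to infinity, so the bounds do not depend on [t]. *)
Lemma gronwall_inv_sqr (R : realType) (f df : R -> R) (c t : R) : 0 <= c -> 1 <= t ->
  (forall s, 1 <= s <= t -> is_derive s 1 (f : R -> R^o) (df s)) ->
  (forall s, 1 <= s <= t -> 0 <= f s) ->
  (forall s, 1 <= s <= t -> `|df s| <= c / s ^+ 2 * f s) ->
  f 1 * expR (- c) <= f t <= f 1 * expR c.
Proof.
move=> c0 t1 hd f0 hb.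
have dE (b s : R) : 1 <= s <= t -> is_derive s 1 (fun s => f s * expR (b * s^-1) : R^o)
    ((df s - b / s ^+ 2 * f s) * expR (b * s^-1)).
  move=> hs; have s0 : s != 0 by case/andP: hs => s1 _; rewrite gt_eqF// (lt_le_trans ltr01).
  have h1 := is_deriveV s0 (is_derive_id s (1 : R)).
  have h2 := @is_derive1_comp _ (fun z => b * z) (fun s => s^-1) s _ _ (is_derive_linear b _) h1.
  have h3 := @is_derive1_comp _ expR (fun s => b * s^-1) s _ _ (is_derive_expR _) h2.
  apply: is_derive_eq (is_deriveM (hd s hs) h3) _.
  by rewrite /GRing.scale/=; field.
have tt : 0 < t := lt_le_trans ltr01 t1.
have ct : 0 <= c * t^-1 by rewrite mulr_ge0// invr_ge0 ltW.
have ft : 0 <= f t by apply: f0; rewrite t1 lexx.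
apply/andP; split.
- have := @derive_ge0_le R _ _ 1 t t1 (dE (- c)).
  rewrite invr1 mulr1 => H; apply: le_trans (H _) _ => [s /andP[/ltW s1 /ltW s2]|].
    rewrite mulr_ge0 ?expR_ge0//; have := hb s; rewrite s1 s2 => /(_ isT).
    by rewrite ler_norml => /andP[]; rewrite mulNr mulNr opprK; lra.
  by rewrite ler_piMr// mulNr -expR0 ler_expR oppr_le0.
- have := @derive_ge0_le R (fun s => - (f s * expR (c * s^-1)))
    (fun s => - ((df s - c / s ^+ 2 * f s) * expR (c * s^-1))) 1 t t1.
  rewrite invr1 mulr1 lerN2 => H; apply: (@le_trans _ _ (f t * expR (c * t^-1))).
    by rewrite ler_peMr// -expR0 ler_expR.
  apply: H => [s hs|s /andP[/ltW s1 /ltW s2]]; first exact: (is_deriveN (dE c s hs)).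
  rewrite -mulNr mulr_ge0 ?expR_ge0//; have := hb s; rewrite s1 s2 => /(_ isT).
  by rewrite ler_norml => /andP[]; lra.
Qed.

(** * Goursat lemma and the identity theorem *)

Section goursat.
Variable R : realType.
Implicit Types (U : R -> R -> R[i]) (s t x y h k : R).

(** The expansion U(s+x, t+y) = U(s,t) + m (x + iy) + o(|x|+|y|): complex
    differentiability of s + it |-> U(s,t). *)
Definition holomorphic_st U : Prop := forall s t, exists m : R[i],
  forall e : R, 0 < e -> exists2 r : R, 0 < r & forall x y, `|x| < r -> `|y| < r ->
    cabs (U (s + x) (t + y) - U s t - m * (x +i* y)) <= e * (`|x| + `|y|).

(** When [T = P + i Q], with [P] a primitive of [U] in [t] and [Q] one in [s], this is
    [- i] times the integral of [U] around the rectangle with corner [(s, t)] and sides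
    [h], [k]. *)
Definition mixed_diff (T : R -> R -> R[i]) s t h k : R[i] :=
  T (s + h) (t + k) - T s (t + k) - T (s + h) t + T s t.

Lemma mixed_diff_quarters T s t h k :
  mixed_diff T s t (h + h) (k + k) =
    mixed_diff T s t h k + mixed_diff T (s + h) t h k +
    (mixed_diff T s (t + k) h k + mixed_diff T (s + h) (t + k) h k).
Proof. by rewrite /mixed_diff !addrA; ring. Qed.

Lemma nested_halves (u : nat -> R) (h : R) : 0 <= h ->
  (forall n, u n <= u n.+1 /\ u n.+1 + h / 2 ^+ n.+1 <= u n + h / 2 ^+ n) ->
  exists x, forall n, u n <= x <= u n + h / 2 ^+ n.
Proof.
move=> h0 hu.
have inc n m : (n <= m)%N -> u n <= u m /\ u m + h / 2 ^+ m <= u n + h / 2 ^+ n.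
  move=> /subnKC <-; elim: (m - n)%N => [|j [ih1 ih2]]; first by rewrite addn0.
  rewrite addnS; have [h1 h2] := hu (n + j)%N.
  by split; [apply: le_trans h1|apply: le_trans ih2].
have hp n : 0 <= h / 2 ^+ n by rewrite divr_ge0// exprn_ge0.
have key n m : u m <= u n + h / 2 ^+ n.
  have [nm|/ltnW mn] := leqP n m.
    by apply: le_trans (inc _ _ nm).2; rewrite lerDl.
  by apply: le_trans (inc _ _ mn).1 _; rewrite lerDl.
exists (sup (range u)) => n; apply/andP; split.
  apply: ub_le_sup; last by exists n.
  by exists (u 0%N + h / 2 ^+ 0) => _ [m _ <-].
by apply: ge_sup; [exists (u 0%N); exists 0%N|move=> _ [m _ <-]].
Qed.

Variables (U : R -> R -> R[i]) (P Q : R -> R -> R[i]) (a b c d : R).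
Hypothesis Uhol : holomorphic_st U.
Hypothesis P_der : forall s t, a <= s <= b -> c <= t <= d ->
  cder (P s) t (U s t).
Hypothesis Q_der : forall s t, a <= s <= b -> c <= t <= d ->
  cder (fun x => Q x t) s (U s t).
Let T s t := P s t + 'i%C * Q s t.

Let cder_lin (m : R[i]) t : cder (fun s => s%:C * m) t m.
Proof.
apply: cder_eq (cderM (cder_real (is_derive_id t 1)) (cder_cst m t)) _.
by rewrite mul1r mulr0 addr0.
Qed.

(** On an affine function the two second differences cancel exactly, so only the
    remainder of the first-order expansion contributes. *)
Lemma mixed_diff_small s0 t0 m e r s t h k : 0 <= e ->
  (forall x y, `|x| < r -> `|y| < r ->
    cabs (U (s0 + x) (t0 + y) - U s0 t0 - m * (x +i* y)) <= e * (`|x| + `|y|)) ->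
  a <= s -> s <= s0 <= s + h -> s + h <= b -> c <= t -> t <= t0 <= t + k -> t + k <= d ->
  h < r -> k < r ->
  cabs (mixed_diff T s t h k) <= 4 * e * (h + k) ^+ 2.
Proof.
move=> e0 hU as_ /andP[ss0 s0h] hb ct /andP[tt0 t0k] kd hr kr.
have hU' x y : s <= x <= s + h -> t <= y <= t + k ->
    cabs (U x y - U s0 t0 - m * ((x - s0) +i* (y - t0))) <= e * (h + k).
  move=> /andP[x1 x2] /andP[y1 y2].
  have ax : `|x - s0| <= h by rewrite ler_norml; apply/andP; split; lra.
  have ay : `|y - t0| <= k by rewrite ler_norml; apply/andP; split; lra.
  have := hU (x - s0) (y - t0) (le_lt_trans ax hr) (le_lt_trans ay kr).
  rewrite !subrKC => /le_trans; apply.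
  by rewrite ler_wpM2l// lerD.
have h0 : 0 <= h by lra.
have k0 : 0 <= k by lra.
pose dP := P (s + h) (t + k) - P s (t + k) - (P (s + h) t - P s t).
pose dQ := Q (s + h) (t + k) - Q (s + h) t - (Q s (t + k) - Q s t).
have HP : cabs (dP - k%:C * (h%:C * m)) <= 4 * e * (h + k) * k.
  have -> : dP - k%:C * (h%:C * m) =
    (P (s + h) (t + k) - P s (t + k) - (t + k)%:C * (h%:C * m)) -
    (P (s + h) t - P s t - t%:C * (h%:C * m)).
    by rewrite /dP rmorphD/=; ring.
  apply: (le_trans (@cder_bound_le R
    (fun y => P (s + h) y - P s y - y%:C * (h%:C * m))
    (fun y => U (s + h) y - U s y - h%:C * m)
    (fun y => 2 * e * (h + k) * y) (fun=> 2 * e * (h + k)) t (t + k) _ _ _ _)).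
  - by rewrite lerDl.
  - move=> y /andP[y1 y2]; apply: cderB; last exact: cder_lin.
    by apply: cderB; apply: P_der; apply/andP; split; lra.
  - by move=> y _; exact: is_derive_linear.
  - move=> y /andP[/ltW y1 /ltW y2].
    have H1 := hU' (s + h) y; have H2 := hU' s y.
    have -> : U (s + h) y - U s y - h%:C * m =
      (U (s + h) y - U s0 t0 - m * ((s + h - s0) +i* (y - t0))) -
      (U s y - U s0 t0 - m * ((s - s0) +i* (y - t0))).
      have -> : h%:C = ((s + h - s0) +i* (y - t0)) - ((s - s0) +i* (y - t0)).
        by apply: complex_eq => /=; ring.
      ring.
    apply: (le_trans (cabsB _ _)).
    have -> : 2 * e * (h + k) = e * (h + k) + e * (h + k) by ring.
    by apply: lerD; [apply: H1|apply: H2]; apply/andP; split; lra.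
  - by apply: eq_ler; ring.
have HQ : cabs (dQ - h%:C * ('i%C * k%:C * m)) <= 4 * e * (h + k) * h.
  have -> : dQ - h%:C * ('i%C * k%:C * m) =
    (Q (s + h) (t + k) - Q (s + h) t - (s + h)%:C * ('i%C * k%:C * m)) -
    (Q s (t + k) - Q s t - s%:C * ('i%C * k%:C * m)).
    by rewrite /dQ rmorphD/=; ring.
  apply: (le_trans (@cder_bound_le R
    (fun x => Q x (t + k) - Q x t - x%:C * ('i%C * k%:C * m))
    (fun x => U x (t + k) - U x t - 'i%C * k%:C * m)
    (fun x => 2 * e * (h + k) * x) (fun=> 2 * e * (h + k)) s (s + h) _ _ _ _)).
  - by rewrite lerDl.
  - move=> x /andP[x1 x2]; apply: cderB; last exact: cder_lin.
    by apply: cderB; apply: Q_der; apply/andP; split; lra.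
  - by move=> y _; exact: is_derive_linear.
  - move=> x /andP[/ltW x1 /ltW x2].
    have H1 := hU' x (t + k); have H2 := hU' x t.
    have -> : U x (t + k) - U x t - 'i%C * k%:C * m =
      (U x (t + k) - U s0 t0 - m * ((x - s0) +i* (t + k - t0))) -
      (U x t - U s0 t0 - m * ((x - s0) +i* (t - t0))).
      have -> : 'i%C * k%:C = ((x - s0) +i* (t + k - t0)) - ((x - s0) +i* (t - t0)).
        by apply: complex_eq => /=; ring.
      ring.
    apply: (le_trans (cabsB _ _)).
    have -> : 2 * e * (h + k) = e * (h + k) + e * (h + k) by ring.
    by apply: lerD; [apply: H1|apply: H2]; apply/andP; split; lra.
  - by apply: eq_ler; ring.
have -> : mixed_diff T s t h k =
    (dP - k%:C * (h%:C * m)) + 'i%C * (dQ - h%:C * ('i%C * k%:C * m)).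
  have i2 : 'i%C * 'i%C = -1 :> R[i] by rewrite -expr2 sqr_i.
  transitivity (dP + 'i%C * dQ - ('i%C * 'i%C + 1) * (k%:C * (h%:C * m))).
    by rewrite i2 addNr mul0r subr0 /dP /dQ /mixed_diff /T; ring.
  ring.
apply: (le_trans (cabsD _ _)); rewrite cabsM cabs_i mul1r.
apply: (le_trans (lerD HP HQ)); apply: eq_ler; ring.
Qed.

Let step (e : R) (n : nat) (p : R * R) : R * R :=
  let h := (b - a) / 2 ^+ n.+1 in let k := (d - c) / 2 ^+ n.+1 in
  xget p [set q | (q.1 = p.1 \/ q.1 = p.1 + h) /\ (q.2 = p.2 \/ q.2 = p.2 + k) /\
    e / 4 ^+ n.+1 <= cabs (mixed_diff T q.1 q.2 h k)].

Let half (x : R) n : x / 2 ^+ n = x / 2 ^+ n.+1 + x / 2 ^+ n.+1.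
Proof. by rewrite exprS invfM mulrCA; lra. Qed.

(** If the second difference were non-zero, then at every scale one quarter would keep its
    share of it, against the expansion of [U] at the point to which the quarters shrink. *)
Lemma goursat : a <= b -> c <= d -> mixed_diff T a c (b - a) (d - c) = 0.
Proof.
move=> ab cd; apply: cabs_eq0; apply/eqP; rewrite -[_ == _]negbK; apply/negP => H.
set e := cabs _ in H; have e0 : 0 < e by rewrite lt_def H cabs_ge0.
pose q := fix q n := if n is n'.+1 then step e n' (q n') else (a, c).
have stepP n p : e / 4 ^+ n <= cabs (mixed_diff T p.1 p.2 ((b - a) / 2 ^+ n) ((d - c) / 2 ^+ n)) ->
    let h := (b - a) / 2 ^+ n.+1 in let k := (d - c) / 2 ^+ n.+1 in
    let q := step e n p in
    (q.1 = p.1 \/ q.1 = p.1 + h) /\ (q.2 = p.2 \/ q.2 = p.2 + k) /\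
    e / 4 ^+ n.+1 <= cabs (mixed_diff T q.1 q.2 h k).
  move=> hp h k; rewrite /step; case: xgetP => [q' -> //|/(_ _) no].
  exfalso; move: hp; rewrite (half (b - a) n) (half (d - c) n) mixed_diff_quarters -/h -/k.
  have lt4 x y : (x = p.1 \/ x = p.1 + h) -> (y = p.2 \/ y = p.2 + k) ->
      cabs (mixed_diff T x y h k) < e / 4 ^+ n.+1.
    move=> hx hy; rewrite ltNge; apply/negP => H'; exact: (no (x, y)).
  have l1 := lt4 p.1 p.2 (or_introl erefl) (or_introl erefl).
  have l2 := lt4 _ p.2 (or_intror erefl) (or_introl erefl).
  have l3 := lt4 p.1 _ (or_introl erefl) (or_intror erefl).
  have l4 := lt4 _ _ (or_intror erefl) (or_intror erefl).
  apply/negP; rewrite -ltNge.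
  apply: (le_lt_trans (cabsD _ _)); apply: (le_lt_trans (lerD (cabsD _ _) (cabsD _ _))).
  apply: (lt_le_trans (ltrD (ltrD l1 l2) (ltrD l3 l4))).
  have p4 : (4 : R) ^+ n != 0 by rewrite expf_neq0// pnatr_eq0.
  by apply: eq_ler; rewrite exprS; field.
have inv n : e / 4 ^+ n <=
    cabs (mixed_diff T (q n).1 (q n).2 ((b - a) / 2 ^+ n) ((d - c) / 2 ^+ n)).
  elim: n => [|n ih]; first by rewrite !expr0 !divr1.
  exact: (stepP _ _ ih).2.2.
have hh n : 0 <= (b - a) / 2 ^+ n by rewrite divr_ge0 ?exprn_ge0// subr_ge0.
have kk n : 0 <= (d - c) / 2 ^+ n by rewrite divr_ge0 ?exprn_ge0// subr_ge0.
have [|n|s0 hs0] := @nested_halves (fun n => (q n).1) (b - a).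
- by rewrite subr_ge0.
- have [/= h1 _] := stepP _ _ (inv n); have hn := hh n.+1; rewrite (half _ n).
  by case: h1 => ->; split; lra.
have [|n|t0 ht0] := @nested_halves (fun n => (q n).2) (d - c).
- by rewrite subr_ge0.
- have [/= _ [h1 _]] := stepP _ _ (inv n); have hn := kk n.+1; rewrite (half _ n).
  by case: h1 => ->; split; lra.
have [qa qc] : (forall n, a <= (q n).1 /\ (q n).1 + (b - a) / 2 ^+ n <= b) /\
    (forall n, c <= (q n).2 /\ (q n).2 + (d - c) / 2 ^+ n <= d).
  split; elim=> [|n [ih1 ih2]]; rewrite ?expr0 ?divr1 ?subrKC ?lexx//.
  - have [/= h1 _] := stepP _ _ (inv n); have hn := hh n.+1; move: ih2; rewrite (half _ n).
    by case: h1 => ->; split; lra.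
  - have [/= _ [h1 _]] := stepP _ _ (inv n); have hn := kk n.+1; move: ih2; rewrite (half _ n).
    by case: h1 => ->; split; lra.
have [m hm] := Uhol s0 t0.
pose L := (b - a) + (d - c) + 1.
have L0 : 0 < L by rewrite /L; lra.
have [r r0 hr] := hm (e / (8 * L ^+ 2)) (divr_gt0 e0 (mulr_gt0 (ltr0n _ 8) (exprn_gt0 2 L0))).
have [n hn] : exists n, L / 2 ^+ n < r.
  exists (Num.bound (L / r)); rewrite ltr_pdivrMr ?exprn_gt0// mulrC -ltr_pdivrMr//.
  have Lr : 0 <= L / r by rewrite divr_ge0 ?ltW.
  apply: (lt_le_trans (archi_boundP Lr)).
  by rewrite -natrX ler_nat ltnW// ltn_expl.
have p2 : 0 < (2 : R) ^+ n by rewrite exprn_gt0.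
have E2 : ((2 : R) ^+ n) ^+ 2 = 4 ^+ n by rewrite -exprM mulnC exprM; congr (_ ^+ _); ring.
have hkL : (b - a) / 2 ^+ n + (d - c) / 2 ^+ n <= L / 2 ^+ n.
  by rewrite -mulrDl ler_pM2r ?invr_gt0// /L; lra.
have hn' := hh n; have kn' := kk n.
have : cabs (mixed_diff T (q n).1 (q n).2 ((b - a) / 2 ^+ n) ((d - c) / 2 ^+ n)) <=
    4 * (e / (8 * L ^+ 2)) * ((b - a) / 2 ^+ n + (d - c) / 2 ^+ n) ^+ 2.
  apply: (@mixed_diff_small s0 t0 m _ r) => //.
  - by rewrite divr_ge0 ?ltW// mulr_gt0// exprn_gt0.
  - exact: (qa n).1.
  - exact: (qa n).2.
  - exact: (qc n).1.
  - exact: (qc n).2.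
  - by apply: le_lt_trans hn; apply: le_trans hkL; rewrite lerDl.
  - by apply: le_lt_trans hn; apply: le_trans hkL; rewrite lerDr.
move=> /(le_trans (inv n)); apply/negP; rewrite -ltNge.
have sq : ((b - a) / 2 ^+ n + (d - c) / 2 ^+ n) ^+ 2 <= (L / 2 ^+ n) ^+ 2.
  by rewrite ler_sqr ?nnegrE// ?addr_ge0// divr_ge0// ltW.
have cc : 0 <= 4 * (e / (8 * L ^+ 2)).
  by rewrite mulr_ge0// divr_ge0 ?ltW// mulr_gt0// exprn_gt0.
apply: (le_lt_trans (ler_wpM2l cc sq)).
have -> : 4 * (e / (8 * L ^+ 2)) * (L / 2 ^+ n) ^+ 2 = e / 4 ^+ n / 2.
  by rewrite expr_div_n E2; field; rewrite expf_neq0 ?pnatr_eq0// gt_eqF.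
have : 0 < e / 4 ^+ n by rewrite divr_gt0// exprn_gt0.
lra.
Qed.
End goursat.

Section mean_value.
Variable R : realType.
Implicit Types (U : R -> R -> R[i]) (F : R[i] -> R[i]) (z p h : R[i]).

Lemma antiderivative_real (f : R -> R) (a b : R) : continuous (f : R -> R^o) ->
  exists G : R -> R, forall x, a < x < b -> is_derive x 1 (G : R -> R^o) (f x).
Proof.
move=> cf.
have [ab|ba] := ltP a b; last first.
  by exists (fun=> 0) => x /andP[ax xb]; have := lt_trans ax xb; rewrite ltNge ba.
exists (fun x => \int[lebesgue_measure]_(t in [set` `[a, x]]) f t)%R => x /andP[ax xb].
have fi : (@lebesgue_measure R).-integrable `[a, b] (EFin \o f).
  apply: continuous_compact_integrable; first exact: segment_compact.
  exact: continuous_subspaceT.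
have [h1 h2] := continuous_FTC1_closed xb fi ax (cf x).
by apply: DeriveDef; [exact: h1|rewrite -derive1E; exact: h2].
Qed.

Lemma antiderivative (f : R -> R[i]) (a b : R) :
  continuous (fun x => complex.Re (f x) : R^o) ->
  continuous (fun x => complex.Im (f x) : R^o) ->
  exists G : R -> R[i], forall x, a < x < b -> cder G x (f x).
Proof.
move=> /(antiderivative_real a b)[G1 h1] /(antiderivative_real a b)[G2 h2].
by exists (fun x => G1 x +i* G2 x) => x xab; split; [exact: h1|exact: h2].
Qed.

Definition cdifferentiable F z : Prop := exists d : R[i], forall e : R, 0 < e ->
  exists2 r : R, 0 < r & forall h, cabs h < r ->
    cabs (F (z + h) - F z - h * d) <= e * cabs h.

Lemma cdiff_continuous F z : cdifferentiable F z -> forall e : R, 0 < e ->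
  exists2 r : R, 0 < r & forall h, cabs h < r -> cabs (F (z + h) - F z) < e.
Proof.
move=> [d hd] e e0; have [r r0 hr] := hd 1 ltr01.
pose c := 1 + cabs d; have c0 : 0 < c by rewrite /c ltr_pwDl ?cabs_ge0.
exists (Num.min r (e / c)); first by rewrite lt_min r0 divr_gt0.
move=> h; rewrite lt_min => /andP[/hr h1]; rewrite ltr_pdivlMr// => h2.
rewrite -(subrK (h * d) (F (z + h) - F z)).
apply: (le_lt_trans (cabsD _ _)); apply: le_lt_trans h2.
by rewrite cabsM /c mulrDr lerD// mulr1 -[leRHS]mul1r.
Qed.

Lemma holomorphic_st_continuous U : holomorphic_st U -> forall (s t e : R), 0 < e ->
  exists2 r : R, 0 < r & forall x y, `|x| < r -> `|y| < r ->
    cabs (U (s + x) (t + y) - U s t) < e.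
Proof.
move=> hU s t e e0; have [m hm] := hU s t; have [r r0 hr] := hm 1 ltr01.
pose c := 2 * (1 + cabs m); have c0 : 0 < c by rewrite /c mulr_gt0// ltr_pwDl ?cabs_ge0.
exists (Num.min r (e / c)); first by rewrite lt_min r0 divr_gt0.
move=> x y; rewrite !lt_min => /andP[x1 x2] /andP[y1 y2].
have := hr x y x1 y1; rewrite mul1r => h1.
rewrite -(subrK (m * (x +i* y)) (U (s + x) (t + y) - U s t)).
apply: (le_lt_trans (cabsD _ _)).
apply: (@le_lt_trans _ _ ((1 + cabs m) * (`|x| + `|y|))).
  rewrite mulrDl mul1r lerD// cabsM ler_wpM2l ?cabs_ge0//.
  exact: cabs_ReIm.
have := ltrD x2 y2; have -> : e / c + e / c = e / (1 + cabs m).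
  by rewrite /c; field; rewrite gt_eqF// ltr_pwDl ?cabs_ge0.
by rewrite ltr_pdivlMr ?ltr_pwDl ?cabs_ge0// mulrC.
Qed.

Lemma continuous_of_cabs (f : R -> R[i]) :
  (forall t e : R, 0 < e ->
    exists2 r : R, 0 < r & forall x, `|x| < r -> cabs (f (t + x) - f t) < e) ->
  continuous (fun x => complex.Re (f x) : R^o) /\
  continuous (fun x => complex.Im (f x) : R^o).
Proof.
move=> hf; split=> t; apply/cvgrPdist_lt => e e0; have [r r0 hr] := hf t e e0;
  exists r => //= y; rewrite /ball_/= => ty; have := hr (y - t);
  rewrite subrKC distrC => /(_ ty); rewrite cabs_dist; apply: le_lt_trans.
- by rewrite -RecN -RecD; exact: normRe_cabs.
- by rewrite -ImcN -ImcD; exact: normIm_cabs.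
Qed.

(** [exp (s + i t)] *)
Definition cexp_st (s t : R) : R[i] := (expR s)%:C * cexpi t.

Lemma cexp_stD s s' t t' : cexp_st (s + s') (t + t') = cexp_st s t * cexp_st s' t'.
Proof. by rewrite /cexp_st expRD cexpiD rmorphM/=; ring. Qed.

Lemma cexp_st_expansion (e : R) : 0 < e -> exists2 r : R, 0 < r & forall x y : R,
  `|x| < r -> `|y| < r ->
  cabs (cexp_st x y - 1 - (x +i* y)) <= e * (`|x| + `|y|).
Proof.
move=> e0.
have [e' [e'0 e'1 e'e]] : exists e', [/\ 0 < e', e' <= 1 & e' <= e / 8].
  exists (Num.min 1 (e / 8)).
  by rewrite lt_min ltr01 divr_gt0// !ge_min !lexx orbT.
have [r1 r10 h1] := is_derive_epsP (is_derive_expR (0 : R)) e'0.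
have [r2 r20 h2] := is_derive_epsP (is_derive_cos (0 : R)) e'0.
have [r3 r30 h3] := is_derive_epsP (is_derive_sin (0 : R)) e'0.
exists (Num.min (Num.min r1 r2) (Num.min r3 e')).
  by rewrite !lt_min r10 r20 r30 e'0.
move=> x y; rewrite !lt_min => /andP[/andP[x1 _] /andP[_ xe]].
move=> /andP[/andP[_ y2] /andP[y3 ye]].
have := h1 _ x1; have := h2 _ y2; have := h3 _ y3.
rewrite !add0r expR0 cos0 sin0 oppr0 !mulr1 !mulr0 !subr0 addr0 => hs hc he.
apply: (le_trans (cabs_ReIm _)); rewrite /cexp_st /= !mul0r subr0 addr0 oppr0 addr0.
have ax : 0 <= `|x| by []. have ay : 0 <= `|y| by [].
have b1 : `|expR x * cos y - 1 - x| <= e' * `|x| + 2 * (e' * `|y|).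
  have -> : expR x * cos y - 1 - x = (expR x - 1 - x) * cos y + (1 + x) * (cos y - 1) by ring.
  apply: (le_trans (ler_normD _ _)); apply: lerD; rewrite normrM.
    by rewrite -[leRHS]mulr1 ler_pM// ler_norml cos_geN1 cos_le1.
  apply: ler_pM => //; apply: (le_trans (ler_normD _ _)); rewrite normr1.
  by have := ltW xe; lra.
have b2 : `|expR x * sin y - y| <= 4 * (e' * `|y|) + e' * `|y|.
  have -> : expR x * sin y - y = (expR x - 1) * sin y + (sin y - y) by ring.
  apply: (le_trans (ler_normD _ _)); apply: lerD => //; rewrite normrM.
  have c1 : `|expR x - 1| <= 2 * e'.
    rewrite -(subrK x (expR x - 1)); apply: (le_trans (ler_normD _ _)).
    apply: (le_trans (lerD he (ltW xe))).
    have : e' * `|x| <= e' by rewrite ger_pMr// (le_trans (ltW xe)).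
    lra.
  have c2 : `|sin y| <= 2 * `|y|.
    rewrite -(subrK y (sin y)); apply: (le_trans (ler_normD _ _)).
    apply: (le_trans (lerD hs (lexx _))).
    have : e' * `|y| <= `|y| by rewrite ler_piMl.
    lra.
  apply: (le_trans (ler_pM _ _ c1 c2)) => //.
  by apply: eq_ler; ring.
apply: (le_trans (lerD b1 b2)).
have m1 : e' * `|x| <= e / 8 * `|x| by rewrite ler_wpM2r.
have m2 : e' * `|y| <= e / 8 * `|y| by rewrite ler_wpM2r.
have m3 : 0 <= e * `|x| by rewrite mulr_ge0// ltW.
have m4 : 0 <= e * `|y| by rewrite mulr_ge0// ltW.
lra.
Qed.

Lemma holomorphic_st_polar F p (rho : R) : 0 <= rho -> (forall z, cdifferentiable F z) ->
  holomorphic_st (fun s t => F (p + rho%:C * cexp_st s t)).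
Proof.
move=> rho0 hF s t; set z := p + _; have [d hd] := hF z.
pose c := rho%:C * cexp_st s t; pose A := cabs c.
have A0 : 0 <= A := cabs_ge0 _.
exists (d * c) => e e0.
pose e1 := Num.min 1 (e / (2 * (A * cabs d + 1))).
have Ad0 : 0 < A * cabs d + 1 by rewrite ltr_wpDl// mulr_ge0// cabs_ge0.
have e10 : 0 < e1 by rewrite lt_min ltr01 divr_gt0// mulr_gt0.
have e11 : e1 <= 1 by rewrite ge_min lexx.
have e1e : e1 <= e / (2 * (A * cabs d + 1)) by rewrite ge_min lexx orbT.
pose e2 := e / (4 * (A + 1)).
have A10 : 0 < A + 1 by rewrite ltr_wpDl.
have e20 : 0 < e2 by rewrite divr_gt0// mulr_gt0.
have [r1 r10 h1] := cexp_st_expansion e10.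
have [r2 r20 h2] := hd e2 e20.
exists (Num.min r1 (r2 / (4 * (A + 1)))); first by rewrite lt_min r10 divr_gt0// mulr_gt0.
move=> x y; rewrite !lt_min => /andP[x1 x2] /andP[y1 y2].
pose w := cexp_st x y - 1.
have hw : cabs (w - (x +i* y)) <= e1 * (`|x| + `|y|) := h1 _ _ x1 y1.
have xy0 : 0 <= `|x| + `|y| by rewrite addr_ge0.
have hw2 : cabs w <= 2 * (`|x| + `|y|).
  rewrite -(subrK (x +i* y) w); apply: (le_trans (cabsD _ _)).
  apply: (le_trans (lerD hw (cabs_ReIm _))) => /=.
  have : e1 * (`|x| + `|y|) <= `|x| + `|y| by rewrite ler_piMl.
  lra.
have -> : p + rho%:C * cexp_st (s + x) (t + y) = z + c * w.
  by rewrite cexp_stD /z /c /w; ring.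
have hcw : cabs (c * w) <= A * (2 * (`|x| + `|y|)) by rewrite cabsM ler_wpM2l.
have hcwr : cabs (c * w) < r2.
  apply: (le_lt_trans hcw).
  apply: (@le_lt_trans _ _ ((A + 1) * (2 * (`|x| + `|y|)))).
    by rewrite ler_wpM2r ?mulr_ge0// lerDl.
  have : `|x| + `|y| < r2 / (2 * (A + 1)).
    have -> : r2 / (2 * (A + 1)) = r2 / (4 * (A + 1)) + r2 / (4 * (A + 1)).
      by field; rewrite gt_eqF.
    exact: ltrD.
  by rewrite ltr_pdivlMr ?mulr_gt0// => /(le_lt_trans _); apply; apply: eq_ler; ring.
have := h2 _ hcwr => hF2.
have -> : F (z + c * w) - F z - d * c * (x +i* y) =
  (F (z + c * w) - F z - c * w * d) + c * d * (w - (x +i* y)) by ring.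
apply: (le_trans (cabsD _ _)).
have -> : e * (`|x| + `|y|) = e / 2 * (`|x| + `|y|) + e / 2 * (`|x| + `|y|) by lra.
apply: lerD.
- apply: (le_trans hF2); apply: (le_trans (ler_wpM2l (ltW e20) hcw)).
  rewrite !mulrA ler_wpM2r//.
  have -> : e / 2 = e2 * (A + 1) * 2 by rewrite /e2; field; rewrite gt_eqF.
  by rewrite ler_wpM2r// ler_wpM2l ?lerDl// ltW.
- rewrite (cabsM (c * d)) (cabsM c d) -/A; apply: (le_trans (ler_wpM2l _ hw)).
    by apply: mulr_ge0 => //; exact: cabs_ge0.
  rewrite mulrA ler_wpM2r//.
  apply: (@le_trans _ _ ((A * cabs d + 1) * e1)).
    by rewrite ler_wpM2r ?lerDl// ltW.
  apply: (le_trans (ler_wpM2l (ltW Ad0) e1e)); apply: eq_ler.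
  by field; rewrite gt_eqF.
Qed.

(** Goursat on [-S, 0] x [0, 2 pi]: by periodicity the integral of [U s] over a
    period is the same at both ends, and at [s = -S] it is close to [2 pi F p]. *)
Lemma mean_value_bound F p (rho e : R) : 0 <= rho -> (forall z, cdifferentiable F z) ->
  (forall t, 0 <= t <= 2 * pi -> cabs (F (p + rho%:C * cexpi t)) <= e) ->
  cabs (F p) <= 2 * e.
Proof.
move=> rho0 hF he; pose U s t := F (p + rho%:C * cexp_st s t).
have hU : holomorphic_st U by exact: holomorphic_st_polar.
have cU := holomorphic_st_continuous hU.
apply/ler_addgt0Pr => e' e'0.
have e'20 : 0 < e' / 2 by lra.
have [r r0 hr] := cdiff_continuous (hF p) e'20.
have [S S0 hS] : exists2 S : R, 0 < S & rho * expR (- S) < r.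
  exists (rho / r + 1); first by rewrite ltr_wpDl// divr_ge0// ltW.
  rewrite expRN ltr_pdivrMr ?expR_gt0// mulrC -ltr_pdivrMr//.
  apply: (lt_le_trans _ (expR_ge1Dx _)); lra.
have Uper s : U s (2 * pi) = U s 0.
  by rewrite /U /cexp_st /cexpi mulr_natl cos2pi sin2pi cos0 sin0.
have pi0 := pi_gt0 R.
have PE s : exists G, forall t, - 1 < t < 2 * pi + 1 -> cder G t (U s t).
  have [|c1 c2] := @continuous_of_cabs (U s); last exact: antiderivative.
  move=> t e0 /(cU s t)[q q0 hq]; exists q => // x xq.
  by have := hq 0 x; rewrite addr0; apply => //; rewrite normr0.
have QE t : exists G, forall s, - S - 1 < s < 1 -> cder G s (U s t).
  have [|c1 c2] := @continuous_of_cabs (U^~ t); last exact: antiderivative.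
  move=> s e0 /(cU s t)[q q0 hq]; exists q => // x xq.
  by have := hq x 0; rewrite addr0; apply => //; rewrite normr0.
have [P hP] := choice PE; have [Q hQ] := choice QE.
have pi2 : 0 <= 2 * pi :> R by rewrite mulr_ge0// ltW.
have G : mixed_diff (fun s t => P s t + 'i%C * Q t s) (- S) 0 (0 - - S) (2 * pi - 0) = 0.
  apply: (@goursat R U P (fun s t => Q t s) (- S) 0 0 (2 * pi)) => //; last by rewrite oppr_le0 ltW.
  - by move=> s t _ /andP[t0 t1]; apply: hP; apply/andP; split; lra.
  - by move=> s t /andP[s0 s1] _; apply: hQ; apply/andP; split; lra.
have SN0 : - S <= 0 by rewrite oppr_le0 ltW.
have Q0 : Q (2 * pi) 0 - Q 0 0 = Q (2 * pi) (- S) - Q 0 (- S).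
  apply/eqP; rewrite -subr_eq0; apply/eqP; apply: cabs_eq0; apply/le_anti.
  rewrite cabs_ge0 andbT.
  apply: (le_trans (@cder_bound_le R (fun s => Q (2 * pi) s - Q 0 s) (fun=> 0)
    (fun s => 0 * s) (fun=> 0) (- S) 0 SN0 _ _ _)).
  - move=> s /andP[s0 s1]; apply: cder_eq (_ : U s (2 * pi) - U s 0 = 0).
      by apply: cderB; apply: hQ; apply/andP; split; lra.
    by rewrite Uper subrr.
  - by move=> s _; exact: is_derive_linear.
  - by move=> s _; rewrite cabs0.
  - by rewrite !mul0r subrr mulr0.
have PP : P 0 (2 * pi) - P 0 0 = P (- S) (2 * pi) - P (- S) 0.
  move: G; rewrite /mixed_diff !(subrKC, add0r).
  move=> G; apply/eqP; rewrite -subr_eq0; apply/eqP.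
  transitivity (P 0 (2 * pi) - P 0 0 - (P (- S) (2 * pi) - P (- S) 0) +
    'i%C * (Q (2 * pi) 0 - Q 0 0 - (Q (2 * pi) (- S) - Q 0 (- S)))).
    by rewrite Q0 subrr mulr0 addr0.
  by rewrite -[RHS]G; ring.
have B0 : cabs (P 0 (2 * pi) - P 0 0) <= 2 * (e * (2 * pi) - e * 0).
  apply: (@cder_bound_le R (P 0) (U 0) (fun t => e * t) (fun=> e)) => //.
  - by move=> t /andP[t0 t1]; apply: hP; apply/andP; split; lra.
  - by move=> t _; exact: is_derive_linear.
  - move=> t /andP[/ltW t0 /ltW t1]; rewrite /U /cexp_st expR0 mul1r.
    by apply: he; rewrite t0.
have B1 : cabs (P (- S) (2 * pi) - (2 * pi)%:C * F p - (P (- S) 0 - (0 : R)%:C * F p)) <=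
    2 * (e' / 2 * (2 * pi) - e' / 2 * 0).
  apply: (@cder_bound_le R (fun t => P (- S) t - t%:C * F p)
    (fun t => U (- S) t - F p) (fun t => e' / 2 * t) (fun=> e' / 2)) => //.
  - move=> t /andP[t0 t1]; apply: cderB; first by apply: hP; apply/andP; split; lra.
    apply: cder_eq (cderM (cder_real (is_derive_id t 1)) (cder_cst (F p) t)) _.
    by rewrite mul1r mulr0 addr0.
  - by move=> t _; exact: is_derive_linear.
  - move=> t _; apply/ltW; apply: hr.
    by rewrite !cabsM cabs_cexpi mulr1 !cabs_real (ger0_norm rho0) (gtr0_norm (expR_gt0 _)).
have B2 : (2 * pi) * cabs (F p) <= 2 * (e * (2 * pi)) + e' * (2 * pi).
  have -> : (2 * pi) * cabs (F p) = cabs ((2 * pi)%:C * F p).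
    by rewrite cabsM cabs_real ger0_norm.
  have -> : (2 * pi)%:C * F p = (P 0 (2 * pi) - P 0 0) -
      (P (- S) (2 * pi) - (2 * pi)%:C * F p - (P (- S) 0 - (0 : R)%:C * F p)).
    by rewrite PP; ring.
  apply: (le_trans (cabsB _ _)); apply: (le_trans (lerD B0 B1)).
  by apply: eq_ler; field.
have pi20 : 0 < 2 * pi :> R by rewrite mulr_gt0.
rewrite -(ler_pM2l pi20); apply: (le_trans B2); apply: eq_ler; ring.
Qed.

Lemma cdiff_cst z p : cdifferentiable (fun=> p) z.
Proof.
exists 0 => e e0; exists 1 => // h _.
by rewrite subrr mulr0 subr0 cabs0 mulr_ge0 ?cabs_ge0// ltW.
Qed.

Lemma cdiff_id z : cdifferentiable id z.
Proof.
exists 1 => e e0; exists 1 => // h _.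
by rewrite (_ : _ - _ = 0) ?cabs0 ?mulr_ge0 ?cabs_ge0 ?ltW//=; ring.
Qed.

Lemma cdiffD F G z : cdifferentiable F z -> cdifferentiable G z ->
  cdifferentiable (fun z => F z + G z) z.
Proof.
move=> [d hd] [d' hd']; exists (d + d') => e e0; have e2 : 0 < e / 2 by lra.
have [r r0 hr] := hd _ e2; have [r' r'0 hr'] := hd' _ e2.
exists (Num.min r r') => [|h]; first by rewrite lt_min r0.
rewrite lt_min => /andP[/hr h1 /hr' h2].
have -> : F (z + h) + G (z + h) - (F z + G z) - h * (d + d') =
  (F (z + h) - F z - h * d) + (G (z + h) - G z - h * d') by ring.
apply: (le_trans (cabsD _ _)); lra.
Qed.

Lemma cdiffM F G z : cdifferentiable F z -> cdifferentiable G z ->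
  cdifferentiable (fun z => F z * G z) z.
Proof.
move=> [d hd] cG; have [d' hd'] := cG; exists (d * G z + F z * d') => e e0.
pose c := cabs (G z) + 1 + cabs (F z) + cabs d.
have c0 : 0 < c by rewrite /c -!addrA ltr_wpDl ?cabs_ge0// ltr_pwDl// addr_ge0 ?cabs_ge0.
have ec : 0 < e / c by rewrite divr_gt0.
have [r1 r10 hr1] := hd _ ec; have [r2 r20 hr2] := hd' _ ec.
have [r3 r30 hr3] := cdiff_continuous cG ec.
have [r4 r40 hr4] := cdiff_continuous cG ltr01.
exists (Num.min (Num.min r1 r2) (Num.min r3 r4)) => [|h].
  by rewrite !lt_min r10 r20 r30.
rewrite !lt_min => /andP[/andP[/hr1 h1 /hr2 h2] /andP[/hr3 /ltW h3 /hr4 /ltW h4]].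
have -> : F (z + h) * G (z + h) - F z * G z - h * (d * G z + F z * d') =
  (F (z + h) - F z - h * d) * (G z + (G (z + h) - G z)) +
  F z * (G (z + h) - G z - h * d') + h * d * (G (z + h) - G z) by ring.
apply: (le_trans (cabsD _ _)).
have hh := cabs_ge0 h; have hd0 := cabs_ge0 d; have hF := cabs_ge0 (F z).
have hGz := cabs_ge0 (G z).
have -> : e * cabs h = (e / c * cabs h) * (cabs (G z) + 1) +
    cabs (F z) * (e / c * cabs h) + cabs h * cabs d * (e / c).
  have -> : e * cabs h = e / c * c * cabs h by rewrite divfK// gt_eqF.
  by rewrite {2}/c; ring.
apply: lerD; last by rewrite !cabsM ler_wpM2l// mulr_ge0.
apply: (le_trans (cabsD _ _)); apply: lerD; last by rewrite cabsM ler_wpM2l.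
rewrite cabsM ler_pM ?cabs_ge0//.
by apply: (le_trans (cabsD _ _)); rewrite lerD2l.
Qed.

Lemma cdiffX F z n : cdifferentiable F z -> cdifferentiable (fun z => F z ^+ n) z.
Proof.
move=> dF; elim: n => [|n ih].
  by under eq_fun do rewrite expr0; exact: cdiff_cst.
by under eq_fun do rewrite exprS; exact: cdiffM.
Qed.

(** Extension by zero across the real axis: the derivative of [h] vanishes on the
    axis because [h] does. *)
Lemma cdiff_cut (h : R[i] -> R[i]) : (forall z, cdifferentiable h z) ->
  (forall x : R, h x%:C = 0) ->
  forall z, cdifferentiable (fun z => if 0 < complex.Im z then h z else 0) z.
Proof.
move=> dh h0 z; have [z0|z0|z0] := ltgtP (complex.Im z) 0.
- exists 0 => e e0; exists (- complex.Im z); first by rewrite oppr_gt0.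
  move=> w hw; rewrite ImcD; have := le_lt_trans (normIm_cabs w) hw.
  rewrite ltr_norml opprK => /andP[_ h2].
  rewrite ifF ?ifF; first by rewrite subrr mulr0 subr0 cabs0 mulr_ge0 ?cabs_ge0// ltW.
    by apply/negbTE; rewrite -leNgt ltW.
  by apply/negbTE; rewrite -leNgt; lra.
- have [d hd] := dh z; exists d => e e0; have [r r0 hr] := hd e e0.
  exists (Num.min r (complex.Im z)); first by rewrite lt_min r0.
  move=> w; rewrite lt_min => /andP[/hr h1 hw].
  have := le_lt_trans (normIm_cabs w) hw; rewrite ltr_norml => /andP[h2 _].
  by rewrite ImcD z0 ifT//; lra.
have [d hd] := dh z.
have hz : h z = 0 by rewrite (_ : z = (complex.Re z)%:C) ?h0//; exact: complex_eq.
have d0 : d = 0.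
  apply: cabs_eq0; apply/eqP; rewrite eq_le cabs_ge0 andbT.
  apply/ler_addgt0Pr => e e0; rewrite add0r; have [r r0 hr] := hd e e0.
  have r2 : 0 < r / 2 by lra.
  have := hr (r / 2)%:C; rewrite cabs_real gtr0_norm// hz.
  have -> : z + (r / 2)%:C = (complex.Re z + r / 2)%:C.
    by apply: complex_eq; rewrite ?RecD ?ImcD/= ?z0 ?addr0.
  rewrite h0 subr0 sub0r cabsN cabsM cabs_real gtr0_norm// (mulrC (r / 2)) ler_pM2r//.
  by apply; lra.
exists 0 => e e0; have [r r0 hr] := hd e e0; exists r => // w /hr.
rewrite hz d0 !mulr0 !subr0 => hw; rewrite z0 ltxx subr0.
by case: ifP => // _; rewrite cabs0 mulr_ge0 ?cabs_ge0// ltW.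
Qed.

(** Identity theorem at the single point [i]. The cut-off [f] of [h] lives on the
    part Im z > 0 of the circle of radius 4 about i; there [1 + eta psi], with
    psi = 2 i zeta - zeta^2 and zeta = (z - i) / 4, has modulus < 1 while it is 1 at i,
    so its powers drive the mean value bound to 0. *)
Lemma entire_eq0_at_i (h : R[i] -> R[i]) : (forall z, cdifferentiable h z) ->
  (forall x : R, h x%:C = 0) -> h 'i%C = 0.
Proof.
move=> dh h0; pose f z := if 0 < complex.Im z then h z else 0.
have df : forall z, cdifferentiable f z := cdiff_cut dh h0.
pose phi z : R[i] := 1 + (24^-1 : R)%:C *
  (2 * 'i%C * ((4^-1 : R)%:C * (z - 'i%C)) + (-1) * ((4^-1 : R)%:C * (z - 'i%C)) ^+ 2).
have dphi z : cdifferentiable phi z.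
  have dz : cdifferentiable (fun z => (4^-1 : R)%:C * (z - 'i%C)) z.
    by apply: cdiffM; [exact: cdiff_cst|apply: cdiffD; [exact: cdiff_id|exact: cdiff_cst]].
  apply: cdiffD; first exact: cdiff_cst.
  apply: cdiffM; first exact: cdiff_cst.
  apply: cdiffD; first by apply: cdiffM => //; exact: cdiff_cst.
  by apply: cdiffM; [exact: cdiff_cst|exact: cdiffX].
have phi_arc t : 0 < complex.Im ('i%C + (4 : R)%:C * cexpi t) ->
    cabs (phi ('i%C + (4 : R)%:C * cexpi t)) ^+ 2 <= 63 / 64.
  move=> hs; have -> : phi ('i%C + (4 : R)%:C * cexpi t) =
    1 + (24^-1 : R)%:C * (2 * 'i%C * cexpi t - cexpi t ^+ 2).
    have q : (4^-1 : R)%:C * (4 : R)%:C = 1 by rewrite -rmorphM/= mulVf ?pnatr_eq0.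
    rewrite /phi mulN1r (_ : (4^-1)%:C * _ = cexpi t)//.
    transitivity ((4^-1 : R)%:C * (4 : R)%:C * cexpi t); first by ring.
    by rewrite q mul1r.
  have cs := cos2Dsin2 t; move: hs.
  rewrite cabs_sqr /cexpi !(expr2, RecD, ImcD, RecM, ImcM, RecN, ImcN) /=.
  move: cs; rewrite !expr2; set C := cos t; set S := sin t => cs hs.
  have hS : - 4^-1 < S by lra.
  have S1 : S <= 1 by exact: sin_le1.
  (* |phi|^2 = 1 + 2 eta Re psi + eta^2 |psi|^2 with eta = 1/24,
     Re psi = 2 S^2 - 2 S - 1 <= -3/8 and |psi|^2 = 5 - 4 S <= 6 for -1/4 < S <= 1. *)
  have hC : C * C = 1 - S * S by lra.
  rewrite hC; apply: (@le_trans _ _ ((1 + 24^-1 * (2 * S * S - 2 * S - 1)) ^+ 2 +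
    24^-1 ^+ 2 * 4 * (1 - S) ^+ 2 * (C * C))); first by apply: eq_ler; ring.
  rewrite hC; apply: (@le_trans _ _ (1 + (2 * (S * S) - 2 * S - 1) / 12 + (5 - 4 * S) / 576)).
    by apply: eq_ler; field.
  have : 0 <= (S + 4^-1) * (5 / 4 - S) by rewrite mulr_ge0; lra.
  lra.
have [M hM] : exists M, forall t, 0 <= t <= 2 * pi ->
    cabs (f ('i%C + (4 : R)%:C * cexpi t)) <= M.
  have c0 : {within `[0, 2 * pi], continuous
      ((fun t => cabs (f ('i%C + (4 : R)%:C * cexpi t))) : R -> R^o)}.
    apply: continuous_subspaceT => t; apply/cvgrPdist_lt => e e0.
    have hst := @holomorphic_st_polar f 'i%C 4 (ler0n _ 4) df.
    have [r r0 hr] := holomorphic_st_continuous hst 0 t e0.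
    exists r => //= y; rewrite /ball_/= => ty.
    have := hr 0 (y - t); rewrite normr0 distrC => /(_ r0 ty).
    rewrite addr0 subrKC /cexp_st expR0 !mul1r; apply: le_lt_trans.
    rewrite ler_norml; apply/andP; split.
      by rewrite lerNl opprB lerBlDr; apply: le_trans (cabsD _ _); rewrite subrK.
    by rewrite lerBlDr cabs_dist; apply: le_trans (cabsD _ _); rewrite subrK.
  have pi2 : 0 <= 2 * pi :> R by rewrite mulr_ge0// pi_ge0.
  have [c _ hc] := EVT_max pi2 c0.
  by exists (cabs (f ('i%C + (4 : R)%:C * cexpi c))) => t ht; apply: hc; rewrite in_itv.
have M0 : 0 <= M by apply: le_trans (hM 0 _); rewrite ?cabs_ge0// lexx mulr_ge0// pi_ge0.
have bnd n : cabs (h 'i%C) <= 2 * (M * (63 / 64) ^+ n).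
  have fi : h 'i%C = f 'i%C * (phi 'i%C ^+ 2) ^+ n.
    rewrite /f /= ltr01 /phi subrr !mulr0 expr0n/= mulr0 addr0 mulr0 addr0.
    by rewrite !expr1n mulr1.
  rewrite fi; apply: (@mean_value_bound (fun z => f z * (phi z ^+ 2) ^+ n) 'i%C 4) => //.
    by move=> z; apply: cdiffM => //; do 2!apply: cdiffX.
  move=> t ht; rewrite cabsM; case: (ltP 0 (complex.Im ('i%C + (4 : R)%:C * cexpi t))) => hI.
    rewrite ler_pM ?cabs_ge0 ?hM// cabsX.
    by rewrite lerXn2r ?nnegrE ?cabs_ge0 ?divr_ge0// cabsX phi_arc.
  have -> : f ('i%C + (4 : R)%:C * cexpi t) = 0 by rewrite /f ltNge hI.
  by rewrite cabs0 mul0r mulr_ge0// exprn_ge0// divr_ge0.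
apply: cabs_eq0; apply/le_anti; rewrite cabs_ge0 andbT.
apply/ler_addgt0Pr => e e0; rewrite add0r.
have cvg0 : ((63 / 64 : R) ^+ n : R^o) @[n --> \oo] --> (0 : R^o).
  by apply: cvg_expr; rewrite ger0_norm ?divr_ge0//; lra.
have e'0 : 0 < e / (2 * (M + 1)) by rewrite divr_gt0// mulr_gt0// ltr_wpDl.
move/cvgrPdist_lt/(_ _ e'0) : cvg0 => [n _ /(_ n (leqnn n))/=].
rewrite sub0r normrN ger0_norm ?exprn_ge0 ?divr_ge0// ltr_pdivlMr ?mulr_gt0 ?ltr_wpDl// => hn.
apply: (le_trans (bnd n)); apply: le_trans (ltW hn).
apply: (@le_trans _ _ ((63 / 64) ^+ n * (2 * M))); first by apply: eq_ler; ring.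
by rewrite ler_wpM2l ?exprn_ge0 ?divr_ge0// ler_wpM2l// lerDl.
Qed.

End mean_value.

(** * Roots and the reflection group *)

Section euclidean.
Variables (R : realType) (n : nat).
Implicit Types (a b x y : 'cV[R]_n) (c : R) (A : 'M[R]_n).

Lemma dotpE (K : comNzRingType) (u v : 'cV[K]_n) : dotp u v = (u^T *m v) 0 0.
Proof. by rewrite mxE; apply: eq_bigr => i _; rewrite mxE. Qed.

Lemma dotpC (K : comNzRingType) (u v : 'cV[K]_n) : dotp u v = dotp v u.
Proof. by apply: eq_bigr => i _; rewrite mulrC. Qed.

Lemma dotpDr (K : comNzRingType) (u v w : 'cV[K]_n) :
  dotp u (v + w) = dotp u v + dotp u w.
Proof. by rewrite !dotpE mulmxDr mxE. Qed.

Lemma dotpZr (K : comNzRingType) (c : K) (u v : 'cV[K]_n) :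
  dotp u (c *: v) = c * dotp u v.
Proof. by rewrite !dotpE -scalemxAr mxE. Qed.

Lemma dotpDl (K : comNzRingType) (u v w : 'cV[K]_n) :
  dotp (v + w) u = dotp v u + dotp w u.
Proof. by rewrite dotpC dotpDr !(dotpC u). Qed.

Lemma dotpZl (K : comNzRingType) (c : K) (u v : 'cV[K]_n) :
  dotp (c *: u) v = c * dotp u v.
Proof. by rewrite dotpC dotpZr dotpC. Qed.

Lemma dotpNr (K : comNzRingType) (u v : 'cV[K]_n) : dotp u (- v) = - dotp u v.
Proof. by rewrite -scaleN1r dotpZr mulN1r. Qed.

Lemma dotpNl (K : comNzRingType) (u v : 'cV[K]_n) : dotp (- u) v = - dotp u v.
Proof. by rewrite dotpC dotpNr dotpC. Qed.

Lemma dotp0r (K : comNzRingType) (u : 'cV[K]_n) : dotp u 0 = 0.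
Proof. by rewrite -(scale0r 0) dotpZr mul0r. Qed.

Lemma dotp_mxl A x y : dotp (A *m x) y = dotp x (A^T *m y).
Proof. by rewrite !dotpE trmx_mul mulmxA. Qed.

Lemma dotp_toC x y : dotp (toC x) (toC y) = (dotp x y)%:C.
Proof. by rewrite rmorph_sum; apply: eq_bigr => i _; rewrite !mxE -rmorphM. Qed.

Lemma dotp_ge0 x : 0 <= dotp x x.
Proof. by apply: sumr_ge0 => i _; rewrite -expr2 sqr_ge0. Qed.

Lemma dotp_gt0 x : x != 0 -> 0 < dotp x x.
Proof.
rewrite lt_def dotp_ge0 andbT; apply: contraNneq => /eqP.
rewrite psumr_eq0 => [/allP h|i _]; last by rewrite -expr2 sqr_ge0.
apply/eqP/colP => i; rewrite mxE; apply/eqP; rewrite -sqrf_eq0 expr2.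
by apply: h; rewrite mem_index_enum.
Qed.

Lemma enorm_ge0 x : 0 <= enorm x.
Proof. exact: sqrtr_ge0. Qed.

(** Cauchy-Schwarz, from the discriminant of [t |-> |x - t y|^2]. *)
Lemma dotp_le_enorm x y : dotp x y <= enorm x * enorm y.
Proof.
have [->|y0] := eqVneq y 0; first by rewrite dotp0r mulr_ge0 ?enorm_ge0.
have yy := dotp_gt0 y0.
rewrite -sqrtrM ?dotp_ge0// (le_trans (ler_norm _))// -sqrtr_sqr ler_sqrt ?mulr_ge0 ?dotp_ge0//.
have := dotp_ge0 (x - (dotp x y / dotp y y) *: y).
have -> : dotp (x - (dotp x y / dotp y y) *: y) (x - (dotp x y / dotp y y) *: y) =
    dotp x x - dotp x y ^+ 2 / dotp y y.
  rewrite !(dotpDl, dotpDr, dotpNl, dotpNr, dotpZl, dotpZr) (dotpC y x).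
  by field; rewrite gt_eqF.
by rewrite subr_ge0 ler_pdivrMr.
Qed.

Lemma reflE a x : reflmx a *m x = x - (2 / dotp a a * dotp a x) *: a.
Proof.
rewrite mulmxBl mul1mx -scalemxAl -mulmxA -scalerA; congr (_ - _ *: _).
apply/colP => i; rewrite !mxE big_ord1 mulrC; congr (_ * _).
by rewrite dotpE.
Qed.

Lemma reflmx_tr a : (reflmx a)^T = reflmx a.
Proof. by rewrite /reflmx linearB/= linearZ/= trmx1 trmx_mul trmxK. Qed.

Lemma mulmx_col_inj A B : (forall x, A *m x = B *m x) -> A = B.
Proof.
move=> h; apply/matrixP => i j.
by have /colP/(_ i) := h (delta_mx j 0); rewrite -!colE !mxE.
Qed.

Lemma reflmxK a x : reflmx a *m (reflmx a *m x) = x.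
Proof.
have [->|a0] := eqVneq a 0; first by rewrite !reflE !scaler0 !subr0.
have aa := dotp_gt0 a0; rewrite !reflE !(dotpDr, dotpNr, dotpZr).
rewrite -addrA -opprD -scalerDl.
rewrite [X in X *: a](_ : _ = 0) ?scale0r ?subr0//.
by field; rewrite gt_eqF.
Qed.

Lemma reflmx_inv a : reflmx a *m reflmx a = 1%:M.
Proof. by apply: mulmx_col_inj => x; rewrite -mulmxA reflmxK mul1mx. Qed.

Lemma reflmx_root a : a != 0 -> reflmx a *m a = - a.
Proof.
move=> /dotp_gt0 aa; rewrite reflE divfK ?gt_eqF// scaler_nat mulr2n.
by rewrite opprD addrA subrr add0r.
Qed.

Lemma reflmxN a : reflmx (- a) = reflmx a.
Proof.
by apply: mulmx_col_inj => x; rewrite !reflE !(dotpNl, dotpNr) opprK mulrN scaleNr scalerN opprK.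
Qed.

Lemma reflmx_conj A a x : A^T *m A = 1%:M ->
  reflmx (A *m a) *m (A *m x) = A *m (reflmx a *m x).
Proof.
move=> AA; rewrite !reflE mulmxBr -scalemxAr.
by rewrite !(dotp_mxl A) !mulmxA AA !mul1mx.
Qed.

End euclidean.

Lemma perm_map_stable (T : eqType) (s : seq T) (h : T -> T) : uniq s ->
  {in s &, injective h} -> (forall x, x \in s -> h x \in s) ->
  perm_eq [seq h x | x <- s] s.
Proof.
move=> us hi hs; have um : uniq [seq h x | x <- s] by rewrite map_inj_in_uniq.
have sub : {subset [seq h x | x <- s] <= s} by move=> _ /mapP[x xs ->]; exact: hs.
have [|_ e] := uniq_min_size um sub; first by rewrite size_map.
exact: uniq_perm.
Qed.

Section root_system.
Variables (R : realType) (n : nat) (Rt Rp : {fset 'cV[R]_n}).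
Hypotheses (hRt : reduced_root_system Rt) (hRp : positive_subsystem Rt Rp).
Implicit Types (a b x y : 'cV[R]_n) (g h : 'M[R]_n).

Lemma root_nz a : a \in Rt -> a != 0.
Proof. by apply: contraTneq => ->; exact: root_neq0 hRt. Qed.

Lemma root_opp a : a \in Rt -> - a \in Rt.
Proof. by move=> aR; rewrite -reflmx_root ?root_nz//; exact: (root_refl hRt). Qed.

Lemma pos_root a : a \in Rp -> a \in Rt.
Proof. by case: hRp => b _ h; rewrite h => /andP[]. Qed.

Lemma pos_or_neg a : a \in Rt -> (a \in Rp) || (- a \in Rp).
Proof.
case: hRp => b b0 h aR; rewrite !h aR root_opp//= dotpNl oppr_gt0 -neq_lt eq_sym.
exact: b0.
Qed.

Lemma pos_not_neg a : a \in Rp -> - a \notin Rp.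
Proof.
case: hRp => b _ h; rewrite !h => /andP[_ ab].
by rewrite negb_and dotpNl oppr_gt0 -leNgt (ltW ab) orbT.
Qed.

(** Orthogonality and stability of the roots go together in the induction because the
    inverse of [g] is its transpose. *)
Lemma reflection_group_orth_stable g : reflection_group Rt g ->
  [/\ g^T *m g = 1%:M, g *m g^T = 1%:M, forall a, a \in Rt -> g *m a \in Rt &
    forall a, a \in Rt -> g^T *m a \in Rt].
Proof.
elim=> [a aR||{}g h _ [g1 g2 g3 g4] _ [h1 h2 h3 h4]|{}g _ [g1 g2 g3 g4]].
- rewrite reflmx_tr !reflmx_inv; split=> // b bR; exact: (root_refl hRt).
- by rewrite trmx1 !mulmx1; split=> // a aR; rewrite mul1mx.
- rewrite trmx_mul; split.
  + by rewrite -mulmxA (mulmxA g^T) g1 mul1mx.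
  + by rewrite -mulmxA (mulmxA h) h2 mul1mx.
  + by move=> a aR; rewrite -mulmxA; apply: g3; exact: h3.
  + by move=> a aR; rewrite -mulmxA; apply: h4; exact: g4.
- have -> : invmx g = g^T.
    have gU : g \in unitmx by case: (mulmx1_unit g1).
    by rewrite -[LHS]mul1mx -g1 -mulmxA mulmxV// mulmx1.
  by rewrite trmxK.
Qed.

Lemma reflection_group_tr g : reflection_group Rt g -> reflection_group Rt g^T.
Proof.
move=> hg; have [g1 _ _ _] := reflection_group_orth_stable hg.
suff <- : invmx g = g^T by exact: RG_inv.
have gU : g \in unitmx by case: (mulmx1_unit g1).
by rewrite -[LHS]mul1mx -g1 -mulmxA mulmxV// mulmx1.
Qed.

Lemma refl_pos_group a : a \in Rp -> reflection_group Rt (reflmx a).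
Proof. by move=> /pos_root; exact: RG_refl. Qed.

Lemma group_ext g h : (forall a, a \in Rt -> g *m a = h *m a) -> g = h.
Proof.
move=> gh; apply: mulmx_col_inj => x.
have xs : x \in <<in_tuple Rt>>%VS by rewrite (root_span hRt) memvf.
rewrite (coord_span xs) !mulmx_sumr; apply: eq_bigr => i _.
by rewrite -!scalemxAr gh// mem_nth.
Qed.

(** A group element is determined by the permutation of the finite spanning set [Rt]
    that it induces. *)
Lemma reflection_group_finite : exists2 s : seq 'M[R]_n, uniq s &
  forall g, (g \in s) <-> reflection_group Rt g.
Proof.
pose act (f : {ffun Rt -> Rt}) g := reflection_group Rt g /\
  forall a : Rt, g *m val a = val (f a).
pose s0 := [seq xget 1%:M [set g | act f g] | f <- enum {: {ffun Rt -> Rt}}].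
exists [seq g <- undup s0 | `[< reflection_group Rt g >]].
  by rewrite filter_uniq// undup_uniq.
move=> g; rewrite mem_filter mem_undup; split=> [/andP[/asboolP]//|hg].
apply/andP; split; first exact/asboolP.
have [_ _ gR _] := reflection_group_orth_stable hg.
pose f := [ffun a : Rt => [`gR _ (valP a)]%fset : Rt].
apply/mapP; exists f; first by rewrite mem_enum.
have hf : act f g by split=> // a; rewrite ffunE.
case: xgetP => [h _ [_ hh]|/(_ g)//].
apply: group_ext => a aR.
by have := hh [` aR]%fset; rewrite -hf.2.
Qed.

(** The group permutes the positive roots up to signs. *)
Lemma sum_pos_group (V : nmodType) (F : 'cV[R]_n -> V) g :
  reflection_group Rt g -> (forall a, a \in Rt -> F (- a) = F a) ->
  \sum_(a <- Rp) F (g *m a) = \sum_(a <- Rp) F a.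
Proof.
move=> hg Fe; have [g1 g2 g3 g4] := reflection_group_orth_stable hg.
pose h a := if g *m a \in Rp then g *m a else - (g *m a).
have hp : perm_eq [seq h a | a <- Rp] Rp.
  apply: perm_map_stable; first exact: fset_uniq.
  - have gi a b : g *m a = g *m b -> a = b.
      by move=> /(congr1 (mulmx g^T)); rewrite !mulmxA g1 !mul1mx.
    move=> a b aP bP; rewrite /h; case: ifP => _; case: ifP => _.
    + exact: gi.
    + rewrite -mulmxN => /gi ab; by have := pos_not_neg bP; rewrite -ab aP.
    + rewrite -mulmxN => /gi ab; by have := pos_not_neg aP; rewrite ab bP.
    + by move/oppr_inj/gi.
  - move=> a aP; rewrite /h; case: ifPn => // nP.
    by have := pos_or_neg (g3 _ (pos_root aP)); rewrite (negbTE nP).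
rewrite -[RHS](perm_big _ hp)/= big_map big_seq [RHS]big_seq.
by apply: eq_bigr => a aP; rewrite /h; case: ifP => // _; rewrite Fe// g3// pos_root.
Qed.

Lemma mult_opp (k : 'cV[R]_n -> R) a : multiplicity Rt k -> a \in Rt -> k (- a) = k a.
Proof.
move=> hk aR; rewrite -reflmx_root ?root_nz//.
by apply: (mult_inv hk) => //; exact: RG_refl.
Qed.

End root_system.

(** * Euler equation along rays *)

Section holomorphic_lines.

(** Over an abstract field, where the topology of [jointly_differentiable] lives; its use
    is at the complex numbers. *)
Lemma jointly_differentiable_line (K : numFieldType) (n : nat)
    (E : 'cV[K]_n -> 'cV[K]_n -> K) (x y u v : 'cV[K]_n) :
  jointly_differentiable E -> exists d : K, forall e : K, 0 < e ->
    exists2 r : K, 0 < r & forall h : K, `|h| < r ->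
      `|E (x + h *: u) (y + h *: v) - E x y - h * d| <= e * `|h|.
Proof.
move=> /(_ (x, y)) /(@diff_derivable _ _ _ _ _ (u, v)) /derivable_eps H.
exists ('D_(u, v) (fun q => E q.1 q.2 : K^o) (x, y)) => e /H[r r0 hr].
by exists r => // h /hr /=; rewrite [h *: u + x]addrC [h *: v + y]addrC.
Qed.

Variables (R : realType) (n : nat) (E : 'cV[R[i]]_n -> 'cV[R[i]]_n -> R[i]).
Hypothesis hE : jointly_differentiable E.
Implicit Types (x y u v : 'cV[R[i]]_n).

Lemma kernel_line_eps x y u v : exists d : R[i], forall e : R, 0 < e ->
    exists2 r : R, 0 < r & forall h : R[i], cabs h < r ->
      cabs (E (x + h *: u) (y + h *: v) - E x y - h * d) <= e * cabs h.
Proof.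
have [d hd] := @jointly_differentiable_line _ _ E x y u v hE; exists d => e e0.
have [|r r0 hr] := hd e%:C; first by rewrite ltcR.
move: r0; rewrite ltcE /= => /andP[/eqP r1 r2].
exists (complex.Re r) => // h hh.
have := hr h; rewrite !norm_cabs -rmorphM/= lecR; apply.
by rewrite ltcE/= r1 eqxx.
Qed.

Lemma cdiff_kernel_line x y u v (z : R[i]) :
  cdifferentiable (fun z => E (x + z *: u) (y + z *: v)) z.
Proof.
have [d hd] := kernel_line_eps (x + z *: u) (y + z *: v) u v; exists d => e /hd[r r0 hr].
by exists r => // h /hr; rewrite !scalerDl !addrA.
Qed.

Implicit Types (p xi : 'cV[R]_n).

Lemma toCD p xi : toC (p + xi) = toC p + toC xi.
Proof. by rewrite /toC map_mxD. Qed.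

Lemma toCZ (c : R) xi : toC (c *: xi) = c%:C *: toC xi.
Proof. by rewrite /toC map_mxZ. Qed.

Lemma cder_kernel_line y p xi (t : R) :
  cder (fun s => E (toC (p + s *: xi)) y) t
    (rderive xi (fun z => E (toC z) y) (p + t *: xi)).
Proof.
have [d hd] := kernel_line_eps (toC (p + t *: xi)) y (toC xi) 0.
have hd' e : 0 < e -> exists2 r : R, 0 < r & forall h : R, `|h| < r ->
    cabs (E (toC (p + t *: xi + h *: xi)) y - E (toC (p + t *: xi)) y - h%:C * d) <= e * `|h|.
  move=> /hd[r r0 hr]; exists r => // h; rewrite -(cabs_real h) => /hr.
  by rewrite scaler0 addr0 -toCZ -toCD.
have -> : rderive xi (fun z => E (toC z) y) (p + t *: xi) = d.
  apply: complex_eq => /=; apply: (@derive_val _ _ _ _ _ _ _ (is_derive_eps _)) => e /hd'[r r0 hr];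
    exists r => // h /hr; apply: le_trans.
  - by apply: le_trans (normRe_cabs _); rewrite !(RecD, RecN) RecM/= mul0r subr0.
  - by apply: le_trans (normIm_cabs _); rewrite !(ImcD, ImcN) ImcM/= mul0r addr0.
apply: cder_eps => e /hd'[r r0 hr]; exists r => // h /hr.
by rewrite scalerDl addrA.
Qed.

End holomorphic_lines.

Section euler_equation.
Variables (R : realType) (n : nat) (Rt Rp : {fset 'cV[R]_n}) (k : 'cV[R]_n -> R).
Hypotheses (hRt : reduced_root_system Rt) (hRp : positive_subsystem Rt Rp).
Hypothesis hk : multiplicity Rt k.
Variable G : seq 'M[R]_n.
Hypotheses (uG : uniq G) (hG : forall g, (g \in G) <-> reflection_group Rt g).
Implicit Types (x y : 'cV[R]_n) (lam f : 'cV[R]_n -> R[i]) (g : 'M[R]_n).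

Local Notation sg := (@reflmx R n).

(** The eigenvalue equation contracted with [x]: an equation along rays, with a
    regular singular point at the origin. *)
Definition euler_solution lam f : Prop :=
  (forall x (t : R), 0 < t -> cder (fun s => f (s *: x)) t
    (lam x * f (t *: x) - (t^-1)%:C *
       \sum_(a <- Rp) (k a)%:C * (f (t *: x) - f (t *: (sg a *m x))))) /\
  (forall x, exists d, cder (fun s => f (s *: x)) 0 d).

Definition rdot (z w : R[i]) : R :=
  complex.Re z * complex.Re w + complex.Im z * complex.Im w.

Lemma rdotDr z w w' : rdot z (w + w') = rdot z w + rdot z w'.
Proof. by rewrite /rdot RecD ImcD; ring. Qed.

Lemma rdotNr z w : rdot z (- w) = - rdot z w.
Proof. by rewrite /rdot RecN ImcN; ring. Qed.

Lemma rdotZr z (c : R) w : rdot z (c%:C * w) = c * rdot z w.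
Proof. by rewrite /rdot RecM ImcM/=; ring. Qed.

Lemma rdot_sumr (I : Type) (s : seq I) z (F : I -> R[i]) :
  rdot z (\sum_(i <- s) F i) = \sum_(i <- s) rdot z (F i).
Proof.
elim/big_rec2: _ => [|i x y _ <-]; first by rewrite /rdot/= !mulr0 addr0.
by rewrite rdotDr.
Qed.

Lemma rdot_mul z w : rdot z (w * z) = complex.Re w * cabs z ^+ 2.
Proof. by rewrite /rdot cabs_sqr RecM ImcM; ring. Qed.

Lemma rdotzz z : rdot z z = cabs z ^+ 2.
Proof. by rewrite /rdot cabs_sqr !expr2. Qed.

Lemma rdot_le z w : `|rdot z w| <= (cabs z ^+ 2 + cabs w ^+ 2) / 2.
Proof.
rewrite !cabs_sqr /rdot ler_norml; apply/andP; split.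
- have := sqr_ge0 (complex.Re z + complex.Re w).
  have := sqr_ge0 (complex.Im z + complex.Im w).
  lra.
- have := sqr_ge0 (complex.Re z - complex.Re w).
  have := sqr_ge0 (complex.Im z - complex.Im w).
  lra.
Qed.

Lemma rdot_le_mul z w : `|rdot z w| <= cabs z * cabs w.
Proof.
have -> : rdot z w = complex.Re (z * (complex.Re w +i* - complex.Im w)).
  by rewrite /rdot RecM/=; ring.
apply: (le_trans (normRe_cabs _)); rewrite cabsM ler_wpM2l ?cabs_ge0//.
by rewrite !cabsE/= sqrrN.
Qed.

Definition energy f x (t : R) : R := \sum_(g <- G) cabs (f (t *: (g *m x))) ^+ 2.

Lemma sum_refl_left (V : nmodType) (F : 'M[R]_n -> V) a : a \in Rp ->
  \sum_(g <- G) F (sg a *m g) = \sum_(g <- G) F g.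
Proof.
move=> aP; have hp : perm_eq [seq sg a *m g | g <- G] G.
  apply: perm_map_stable => //.
  - by move=> g h _ _ /(congr1 (mulmx (sg a))); rewrite !mulmxA reflmx_inv !mul1mx.
  - by move=> g /hG hg; apply/hG; apply: RG_mul => //; exact: (refl_pos_group hRp).
by rewrite -[RHS](perm_big _ hp)/= big_map.
Qed.

Definition denergy lam f x (t : R) : R :=
  \sum_(g <- G) 2 * rdot (f (t *: (g *m x))) (lam (g *m x) * f (t *: (g *m x)) -
     (t^-1)%:C * \sum_(a <- Rp) (k a)%:C *
        (f (t *: (g *m x)) - f (t *: (sg a *m (g *m x))))).

Lemma is_derive_sum_seq (I : eqType) (s : seq I) (F : I -> R -> R) (D : I -> R) (t : R) :
  (forall i, i \in s -> is_derive t 1 (F i : R -> R^o) (D i)) ->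
  is_derive t 1 (fun u => \sum_(i <- s) F i u : R^o) (\sum_(i <- s) D i).
Proof.
elim: s => [_|i s ih h].
  by rewrite big_nil; under eq_fun do rewrite big_nil; exact: is_derive_cst.
rewrite big_cons; under eq_fun do rewrite big_cons.
apply: (is_deriveD (h i (mem_head _ _)) (ih _)) => j js.
by apply: h; rewrite inE js orbT.
Qed.

Lemma is_derive_energy lam f x (t : R) : euler_solution lam f -> 0 < t ->
  is_derive t 1 (energy f x : R -> R^o) (denergy lam f x t).
Proof.
move=> [hf _] t0; apply: is_derive_sum_seq => g _.
exact: (is_derive_cabs_sqr (hf (g *m x) t t0)).
Qed.

Lemma is_derive_energy0 lam f x : euler_solution lam f ->
  exists d : R, is_derive (0 : R) 1 (energy f x : R -> R^o) d.
Proof.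
move=> [_ hf]; have [d hd] := choice (fun g => hf (g *m x)).
exists (\sum_(g <- G) 2 * rdot (f (0 *: (g *m x))) (d g)); apply: is_derive_sum_seq => g _.
exact: (is_derive_cabs_sqr (hd g)).
Qed.

(** The reflection part is dissipative: after summation over the group, which is
    permuted by each reflection, the cross terms are dominated by the energy. *)
Lemma denergy_bounds lam f x (t M : R) : 0 < t ->
  (forall g, g \in G -> `|complex.Re (lam (g *m x))| <= M) ->
  - (2 * M + 4 * (\sum_(a <- Rp) k a) / t) * energy f x t <= denergy lam f x t
    <= 2 * M * energy f x t.
Proof.
move=> t0 hM; pose u g := f (t *: (g *m x)).
pose D := \sum_(a <- Rp) k a * \sum_(g <- G) rdot (u g) (u g - u (sg a *m g)).
pose L := \sum_(g <- G) complex.Re (lam (g *m x)) * cabs (u g) ^+ 2.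
have hL : `|L| <= M * energy f x t.
  rewrite /energy mulr_sumr /L (le_trans (ler_norm_sum _ _ _))//.
  rewrite big_seq [leRHS]big_seq; apply: ler_sum => g gG.
  by rewrite normrM (ger0_norm (sqr_ge0 (cabs _))) ler_wpM2r ?sqr_ge0// hM.
have key a : a \in Rp ->
    0 <= \sum_(g <- G) rdot (u g) (u g - u (sg a *m g)) <= 2 * energy f x t.
  move=> aP; have e1 : \sum_(g <- G) cabs (u (sg a *m g)) ^+ 2 = energy f x t.
    by rewrite (@sum_refl_left _ (fun g => cabs (u g) ^+ 2)).
  have e2 : 2^-1 * energy f x t + 2^-1 * energy f x t = energy f x t by lra.
  apply/andP; split.
  - rewrite -[leLHS](subrr (2^-1 * energy f x t)) -{2}e1 /energy !mulr_sumr -sumrB.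
    apply: ler_sum => g _; rewrite rdotDr rdotNr rdotzz -/(u g).
    have := rdot_le (u g) (u (sg a *m g)); rewrite ler_norml => /andP[]; lra.
  - have -> : 2 * energy f x t = 3 / 2 * energy f x t + 2^-1 * energy f x t by lra.
    rewrite -{2}e1 /energy !mulr_sumr -big_split/=.
    apply: ler_sum => g _; rewrite rdotDr rdotNr rdotzz -/(u g).
    have := rdot_le (u g) (u (sg a *m g)); rewrite ler_norml => /andP[]; lra.
have hD : 0 <= D <= 2 * (\sum_(a <- Rp) k a) * energy f x t.
  apply/andP; split.
    rewrite /D big_seq; apply: sumr_ge0 => a aP; apply: mulr_ge0.
      by apply: (mult_ge0 hk); exact: (pos_root hRp).
    by case/andP: (key a aP).
  rewrite mulrAC mulr_sumr /D big_seq [leRHS]big_seq; apply: ler_sum => a aP.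
  rewrite mulrC ler_wpM2r ?(mult_ge0 hk) ?(pos_root hRp)//.
  by case/andP: (key a aP).
have -> : denergy lam f x t = 2 * L - 2 / t * D.
  rewrite /denergy -mulr_sumr -mulrA -mulrBr; congr (2 * _).
  transitivity (\sum_(g <- G) (complex.Re (lam (g *m x)) * cabs (u g) ^+ 2 -
      t^-1 * \sum_(a <- Rp) k a * rdot (u g) (u g - u (sg a *m g)))).
    apply: eq_bigr => g _; rewrite rdotDr rdotNr rdot_mul rdotZr rdot_sumr.
    congr (_ - _ * _); apply: eq_bigr => a _; rewrite rdotZr /u.
    by rewrite mulmxA.
  rewrite sumrB; congr (_ - _); rewrite -mulr_sumr exchange_big/=; congr (_ * _).
  by apply: eq_bigr => a _; rewrite mulr_sumr.
move: hL hD; rewrite ler_norml => /andP[l1 l2] /andP[d1 d2].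
have t20 : 0 <= 2 / t by rewrite divr_ge0// ltW.
have m1 : 2 / t * D <= 2 / t * (2 * (\sum_(a <- Rp) k a) * energy f x t).
  by rewrite ler_wpM2l.
have m2 : 0 <= 2 / t * D by rewrite mulr_ge0.
apply/andP; split; last by lra.
apply: (@le_trans _ _ (- 2 * (M * energy f x t) -
  2 / t * (2 * (\sum_(a <- Rp) k a) * energy f x t))); last by lra.
by apply: eq_ler; field; rewrite gt_eqF.
Qed.

End euler_equation.

Section euler_uniqueness.
Variables (R : realType) (n : nat) (Rt Rp : {fset 'cV[R]_n}) (k : 'cV[R]_n -> R).
Hypotheses (hRt : reduced_root_system Rt) (hRp : positive_subsystem Rt Rp).
Hypothesis hk : multiplicity Rt k.
Variable G : seq 'M[R]_n.
Hypotheses (uG : uniq G) (hG : forall g, (g \in G) <-> reflection_group Rt g).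
Implicit Types (x y : 'cV[R]_n) (lam f : 'cV[R]_n -> R[i]) (g : 'M[R]_n).

Lemma one_in_group : 1%:M \in G.
Proof. by apply/hG; exact: RG_one. Qed.

Lemma energy_le lam f x (M t : R) : euler_solution Rp k lam f ->
  (forall g, g \in G -> `|complex.Re (lam (g *m x))| <= M) -> 0 <= t ->
  energy G f x t <= energy G f x 0 * expR (2 * M * t).
Proof.
move=> hf hM t0; have [d0 hd0] := is_derive_energy0 G x hf.
pose dN (s : R) : R := if 0 < s then denergy Rp k G lam f x s else d0.
have hN (s : R) : 0 <= s -> is_derive s 1 (energy G f x : R -> R^o) (dN s).
  rewrite le_eqVlt /dN => /predU1P[<-|s0]; first by rewrite ltxx.
  by rewrite s0; exact: is_derive_energy.
have := @derive_ge0_le R (fun s => - (energy G f x s * expR (- (2 * M) * s)))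
  (fun s => - (dN s * expR (- (2 * M) * s) +
    energy G f x s * (expR (- (2 * M) * s) * - (2 * M)))) 0 t t0.
rewrite mulr0 expR0 mulr1 lerN2 => H.
suff : energy G f x t * expR (- (2 * M) * t) <= energy G f x 0.
  by rewrite mulNr expRN ler_pdivrMr// expR_gt0.
apply: H => s /andP[s0 s1].
- have h1 := hN s s0.
  have h2 := is_derive1_comp (is_derive_expR (- (2 * M) * s)) (is_derive_linear (- (2 * M)) s).
  apply: is_derive_eq (is_deriveN (is_deriveM h1 h2)) _.
  by rewrite /GRing.scale/=; ring.
- rewrite /dN s0.
  have /andP[_ h] := denergy_bounds hRp hk uG hG f s0 hM.
  have -> : - (denergy Rp k G lam f x s * expR (- (2 * M) * s) +
      energy G f x s * (expR (- (2 * M) * s) * - (2 * M))) =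
    (2 * M * energy G f x s - denergy Rp k G lam f x s) * expR (- (2 * M) * s) by ring.
  by rewrite mulr_ge0 ?expR_ge0// subr_ge0.
Qed.

Lemma energy0E f x : energy G f x 0 = (size G)%:R * cabs (f 0) ^+ 2.
Proof.
rewrite /energy (eq_bigr (fun=> cabs (f 0) ^+ 2)) => [|g _]; last by rewrite scale0r.
exact: sum_const_seq.
Qed.

Lemma le_energy1 f x : cabs (f x) ^+ 2 <= energy G f x 1.
Proof.
rewrite /energy (big_rem _ one_in_group)/= scale1r mul1mx lerDl.
by apply: sumr_ge0 => g _; exact: sqr_ge0.
Qed.

Lemma euler_sub lam f f' : euler_solution Rp k lam f -> euler_solution Rp k lam f' ->
  euler_solution Rp k lam (fun x => f x - f' x).
Proof.
move=> [h1 h2] [h1' h2']; split=> [x t t0|x].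
  apply: cder_eq (cderB (h1 x t t0) (h1' x t t0)) _.
  rewrite (_ : \sum_(a <- Rp) _ * (_ - _ - (_ - _)) =
    \sum_(a <- Rp) (k a)%:C * (f (t *: x) - f (t *: (reflmx a *m x))) -
    \sum_(a <- Rp) (k a)%:C * (f' (t *: x) - f' (t *: (reflmx a *m x)))); first by ring.
  by rewrite -sumrB; apply: eq_bigr => a _; ring.
have [d hd] := h2 x; have [d' hd'] := h2' x; exists (d - d'); exact: cderB.
Qed.

(** In spite of the singular point, the value at 0 determines the solution: the energy of
    a difference starts at 0 and grows at most exponentially. *)
Lemma euler_unique lam f f' : euler_solution Rp k lam f -> euler_solution Rp k lam f' ->
  f 0 = f' 0 -> forall x, f x = f' x.
Proof.
move=> hf hf' e0 x; apply/eqP; rewrite -subr_eq0; apply/eqP; apply: cabs_eq0.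
pose M := \sum_(g <- G) `|complex.Re (lam (g *m x))|.
have hM g : g \in G -> `|complex.Re (lam (g *m x))| <= M.
  by move=> gG; rewrite /M (big_rem _ gG)/= lerDl sumr_ge0.
have := energy_le (euler_sub hf hf') hM ler01.
rewrite energy0E e0 subrr cabs0 expr0n/= mulr0 mul0r => h.
have := le_trans (le_energy1 (fun x => f x - f' x) x) h.
by move=> h'; apply/eqP; rewrite -sqrf_eq0 eq_le h' sqr_ge0.
Qed.

(** For imaginary spectral parameters the energy decreases along rays. *)
Lemma energy_bounded lam f x : euler_solution Rp k lam f ->
  (forall x, complex.Re (lam x) = 0) ->
  energy G f x 1 <= (size G)%:R * cabs (f 0) ^+ 2.
Proof.
move=> hf h0; have := @energy_le lam f x 0 1 hf _ ler01.
rewrite mulr0 mul0r expR0 mulr1 energy0E; apply=> g _.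
by rewrite h0 normr0.
Qed.

(** Backwards in [t] the energy grows at most like a power of [1/t], so it cannot
    vanish at 1 without vanishing near 0. *)
Lemma energy_pos lam f x : euler_solution Rp k lam f ->
  (forall x, complex.Re (lam x) = 0) -> f 0 != 0 -> 0 < energy G f x 1.
Proof.
move=> hf h0 f0; pose gam := 4 * \sum_(a <- Rp) k a.
have hM g : g \in G -> `|complex.Re (lam (g *m x))| <= 0 by rewrite h0 normr0.
have N0 : 0 < energy G f x 0.
  rewrite energy0E mulr_gt0//.
    by rewrite ltr0n; have := one_in_group; case: (G).
  by rewrite exprn_gt0// lt_def cabs_ge0 andbT; apply: contra_neq f0 => /cabs_eq0.
have [d hd] := is_derive_energy0 G x hf.
have [r r0 hr] := is_derive_epsP hd ltr01.
pose c := 2 * (1 + `|d|); have c0 : 0 < c by rewrite mulr_gt0// ltr_pwDl.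
pose t := Num.min 1 (Num.min (r / 2) (energy G f x 0 / c)).
have t0 : 0 < t by rewrite !lt_min ltr01 !divr_gt0.
have t1 : t <= 1 by rewrite ge_min lexx.
have tr : t < r by rewrite (@le_lt_trans _ _ (r / 2)) ?ge_min ?lexx ?orbT//; lra.
have tN : t * c <= energy G f x 0 by rewrite -ler_pdivlMr// !ge_min lexx !orbT.
have Nt : 0 < energy G f x t.
  have := hr t; rewrite gtr0_norm// => /(_ tr); rewrite add0r mul1r ler_norml => /andP[h _].
  have : t * - `|d| <= t * d.
    by rewrite ler_wpM2l ?(ltW t0)// lerNl -normrN ler_norm.
  by move: tN; rewrite /c; nra.
have := @derive_ge0_le R (fun s => energy G f x s * expR (gam * ln s))
  (fun s => denergy Rp k G lam f x s * expR (gam * ln s) +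
    energy G f x s * (expR (gam * ln s) * (gam * s^-1))) t 1 t1.
rewrite ln1 mulr0 expR0 mulr1 => H.
apply: lt_le_trans (H _ _); first by rewrite mulr_gt0// expR_gt0.
- move=> s /andP[ts _]; have s0 := lt_le_trans t0 ts.
  have h1 := is_derive_energy G x hf s0.
  have h2 := is_derive1_comp (is_derive_linear gam (ln s)) (is_derive1_ln s0).
  have h3 := @is_derive1_comp _ expR (fun s => gam * ln s) s _ _ (is_derive_expR (gam * ln s)) h2.
  apply: is_derive_eq (is_deriveM h1 h3) _.
  by rewrite /GRing.scale/=; ring.
- move=> s /andP[ts _]; have s0 := lt_trans t0 ts.
  have /andP[h _] := denergy_bounds hRp hk uG hG f s0 hM.
  have -> : denergy Rp k G lam f x s * expR (gam * ln s) +
      energy G f x s * (expR (gam * ln s) * (gam * s^-1)) =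
    (denergy Rp k G lam f x s + gam / s * energy G f x s) * expR (gam * ln s) by ring.
  rewrite mulr_ge0 ?expR_ge0//; move: h; rewrite mulr0 add0r mulNr -/gam; lra.
Qed.

End euler_uniqueness.

(** * Symmetries of the Dunkl kernel *)

Section dunkl_kernel.
Variables (R : realType) (n : nat) (Rt Rp : {fset 'cV[R]_n}) (k : 'cV[R]_n -> R).
Variable E : 'cV[R[i]]_n -> 'cV[R[i]]_n -> R[i].
Hypotheses (hRt : reduced_root_system Rt) (hRp : positive_subsystem Rt Rp).
Hypotheses (hk : multiplicity Rt k) (hE : is_dunkl_kernel Rp k E).
Variable G : seq 'M[R]_n.
Hypotheses (uG : uniq G) (hG : forall g, (g \in G) <-> reflection_group Rt g).
Implicit Types (x y xi : 'cV[R]_n) (g : 'M[R]_n) (w : 'cV[R[i]]_n).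

(** In the direction of the base point itself the difference quotient has no singularity
    on the hyperplane orthogonal to [a]: there the coefficient [dotp a x] vanishes and
    [a] reflects [x] to itself. *)
Lemma dunkl_quotient_ray f a x (t : R) : 0 < t ->
  (k a * dotp a x)%:C * dunkl_quotient a f (t *: x) =
  (t^-1)%:C * ((k a)%:C * (f (t *: x) - f (t *: (reflmx a *m x)))).
Proof.
move=> t0; rewrite /dunkl_quotient dotpZr mulf_eq0 gt_eqF//=.
case: eqP => [ax|/eqP ax].
  by rewrite ax mulr0 mul0r reflE ax mulr0 scale0r subr0 subrr !mulr0.
rewrite -scalemxAr; set z := _ - _.
have t0' : t%:C != 0 :> R[i] by rewrite (inj_eq (@complexI _)) gt_eqF.
have ax' : (dotp a x)%:C != 0 :> R[i] by rewrite (inj_eq (@complexI _)).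
by rewrite fmorphV !rmorphM/=; field; rewrite t0'.
Qed.

Lemma euler_kernel w :
  euler_solution Rp k (fun x => dotp w (toC x)) (fun x => E (toC x) w).
Proof.
have hol := dunkl_kernel_holomorphic hE.
have ray x t := cder_kernel_line hol w 0 x t.
split=> [x t t0|x]; last first.
  exists (rderive x (fun z => E (toC z) w) (0 + 0 *: x)).
  by have := ray x 0; move/cder_ext; apply => s; rewrite add0r.
have h := ray x t; rewrite add0r in h.
apply: cder_eq (cder_ext h _) _; first by move=> s; rewrite add0r.
have := dunkl_kernel_eigen hE w x (t *: x); rewrite /dunkl_operator => <-.
rewrite mulr_sumr -[LHS]addr0 -addrA; congr (_ + _); apply/esym.
rewrite -sumrN -big_split/= big1// => a _.
by rewrite -(dunkl_quotient_ray (fun z => E (toC z) w) a x t0) addrN.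
Qed.

Lemma kernel_scale_real (w : 'cV[R[i]]_n) (c : R) x :
  E (c%:C *: toC x) w = E (toC x) (c%:C *: w).
Proof.
rewrite -toCZ.
pose lam x := dotp w (toC (c *: x)).
have h1 : euler_solution Rp k lam (fun x => E (toC (c *: x)) w).
  have [h1 h2] := euler_kernel w; split=> [z t t0|z].
    apply: cder_eq (cder_ext (h1 (c *: z) t t0) _) _.
      by move=> s; rewrite !scalerA mulrC.
    rewrite !scalerA (mulrC t c); congr (_ - _ * _); apply: eq_bigr => a _.
    by rewrite -scalemxAr !scalerA (mulrC t c).
  have [d hd] := h2 (c *: z); exists d; apply: (cder_ext hd) => s.
  by rewrite !scalerA mulrC.
have h2 : euler_solution Rp k lam (fun x => E (toC x) (c%:C *: w)).
  have [h1' h2] := euler_kernel (c%:C *: w); split=> [z t t0|//].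
  apply: cder_eq (h1' z t t0) _; congr (_ * _ - _).
  by rewrite /lam toCZ dotpZr dotpZl dotpC.
have := euler_unique hRp hk uG hG h1 h2; apply.
by rewrite scaler0 /toC map_mx0 !(dunkl_kernel_0 hE).
Qed.

(** Both sides are entire in the scalar; they agree for real scalars, hence at [i]. *)
Lemma kernel_imag x y :
  E ('i%C *: toC x) (toC y) = E (toC x) ('i%C *: toC y).
Proof.
have hol := dunkl_kernel_holomorphic hE.
pose h (z : R[i]) := E (z *: toC x) (toC y) + (-1) * E (toC x) (z *: toC y).
have dh z : cdifferentiable h z.
  have h1 := cdiff_kernel_line hol 0 (toC y) (toC x) 0 z.
  have h2 := cdiff_kernel_line hol (toC x) 0 0 (toC y) z.
  rewrite /h; under eq_fun => u.
    rewrite (_ : E (u *: toC x) (toC y) = E (0 + u *: toC x) (toC y + u *: 0)); last first.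
      by rewrite add0r scaler0 addr0.
    rewrite (_ : E (toC x) (u *: toC y) = E (toC x + u *: 0) (0 + u *: toC y)); last first.
      by rewrite add0r scaler0 addr0.
    over.
  apply: cdiffD; first exact: h1.
  by apply: cdiffM; [exact: cdiff_cst|exact: h2].
have h0 (c : R) : h c%:C = 0 by rewrite /h kernel_scale_real mulN1r subrr.
by have := entire_eq0_at_i dh h0; rewrite /h mulN1r => /eqP; rewrite subr_eq0 => /eqP.
Qed.

(** By [kernel_imag] these are also the values for imaginary first argument. *)
Definition osc x y : R[i] := E (toC x) ('i%C *: toC y).

Lemma kernel_osc x y : E ('i%C *: toC x) (toC y) = osc x y.
Proof. exact: kernel_imag. Qed.

Definition phase x y : R[i] := 'i%C * (dotp x y)%:C.

Lemma phase_Re x y : complex.Re (phase x y) = 0.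
Proof. by rewrite RecM/= mul0r mulr0 subr0. Qed.

Lemma euler_osc y : euler_solution Rp k (phase^~ y) (osc^~ y).
Proof.
have [h1 h2] := euler_kernel ('i%C *: toC y); split=> // x t t0.
apply: cder_eq (h1 x t t0) _; congr (_ * _ - _).
by rewrite dotpZl dotp_toC dotpC.
Qed.

Lemma osc0 y : osc 0 y = 1.
Proof. by rewrite /osc /toC map_mx0 (dunkl_kernel_0 hE). Qed.

Lemma osc_scale (c : R) x y : osc (c *: x) y = osc x (c *: y).
Proof. by rewrite /osc !toCZ kernel_scale_real !scalerA mulrC. Qed.

Lemma osc_group g x y : reflection_group Rt g -> osc (g *m x) (g *m y) = osc x y.
Proof.
move=> hg; have [g1 g2 g3 g4] := reflection_group_orth_stable hRt hg.
have h1 : euler_solution Rp k (phase^~ y) (fun x => osc (g *m x) (g *m y)).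
  have [h1 h2] := euler_osc (g *m y); split=> [z t t0|z]; last first.
    by have [d hd] := h2 (g *m z); exists d; apply: (cder_ext hd) => s; rewrite scalemxAr.
  apply: cder_eq (cder_ext (h1 (g *m z) t t0) _) _.
    by move=> s; rewrite scalemxAr.
  rewrite -scalemxAr; congr (_ * _ - _ * _).
    by rewrite /phase dotp_mxl mulmxA g1 mul1mx.
  pose F a := (k a)%:C *
    (osc (t *: (g *m z)) (g *m y) - osc (t *: (reflmx a *m (g *m z))) (g *m y)).
  rewrite -[LHS](@sum_pos_group _ _ _ _ hRt hRp _ F g hg) => [|a aR]; last first.
    by rewrite /F (mult_opp hRt hk aR) reflmxN.
  apply: eq_big_seq => a aP; rewrite /F (mult_inv hk)//; last exact: (pos_root hRp).
  by rewrite reflmx_conj// !scalemxAr.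
by have := euler_unique hRp hk uG hG h1 (euler_osc y); apply; rewrite mulmx0 !osc0.
Qed.

(** As a function of [y] the kernel solves the same Euler equation: dilations and group
    elements can be moved from one argument to the other. *)
Lemma osc_sym x y : osc x y = osc y x.
Proof.
have h1 : euler_solution Rp k (phase^~ x) (osc x).
  have [h1 h2] := euler_osc x; have h3 := euler_osc.
  split=> [z t t0|z]; last first.
    have [_ /(_ x)[d hd]] := h3 z; exists d.
    by apply: (cder_ext hd) => s; rewrite osc_scale.
  have [/(_ x t t0) h4 _] := h3 z.
  apply: cder_eq (cder_ext h4 _) _; first by move=> s; rewrite osc_scale.
  rewrite osc_scale; congr (_ * _ - _ * _); first by rewrite /phase dotpC.
  apply: eq_big_seq => a aP; congr (_ * (_ - _)).
  rewrite osc_scale [in RHS]scalemxAr -(osc_group x _ (refl_pos_group hRp aP)).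
  by rewrite reflmxK.
have := euler_unique hRp hk uG hG h1 (euler_osc x); apply.
by rewrite osc0 -(scale0r x) -osc_scale scale0r osc0.
Qed.

Lemma osc_bounded x y : cabs (osc x y) ^+ 2 <= (size G)%:R.
Proof.
apply: (le_trans (le_energy1 hG (osc^~ y) x)).
have := energy_bounded hRp hk uG hG x (euler_osc y) (phase_Re^~ y).
by rewrite osc0 cabs1 expr1n mulr1.
Qed.

Lemma osc_orbit_pos x y : 0 < \sum_(g <- G) cabs (osc x (g *m y)) ^+ 2.
Proof.
have := energy_pos hRp hk uG hG y (euler_osc x) (phase_Re^~ x).
rewrite osc0 oner_eq0 => /(_ isT); rewrite /energy.
by under eq_bigr do rewrite scale1r osc_sym.
Qed.

Lemma cder_osc x xi y (t : R) : (forall a, a \in Rp -> dotp a (x + t *: xi) != 0) ->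
  cder (fun s => osc (x + s *: xi) y) t
    (phase xi y * osc (x + t *: xi) y -
     \sum_(a <- Rp) (k a * dotp a xi / dotp a (x + t *: xi))%:C *
       (osc (x + t *: xi) y - osc (reflmx a *m (x + t *: xi)) y)).
Proof.
move=> hx; have hol := dunkl_kernel_holomorphic hE.
apply: cder_eq (cder_kernel_line hol ('i%C *: toC y) x xi t) _.
apply/eqP; rewrite -subr_eq opprK; apply/eqP.
have := dunkl_kernel_eigen hE ('i%C *: toC y) xi (x + t *: xi).
rewrite /dunkl_operator dotpZl dotp_toC (dotpC y) => <-; congr (_ + _).
apply: eq_big_seq => a aP; rewrite /dunkl_quotient (negbTE (hx a aP)).
by rewrite fmorph_div/= mulrAC mulrA.
Qed.

End dunkl_kernel.

(** * Amplitudes on the chamber *)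

Section asymptotics.
Variables (R : realType) (n : nat) (Rt Rp : {fset 'cV[R]_n}) (k : 'cV[R]_n -> R).
Variable E : 'cV[R[i]]_n -> 'cV[R[i]]_n -> R[i].
Hypotheses (hRt : reduced_root_system Rt) (hRp : positive_subsystem Rt Rp).
Hypotheses (hk : multiplicity Rt k) (hE : is_dunkl_kernel Rp k E).
Variable G : seq 'M[R]_n.
Hypotheses (uG : uniq G) (hG : forall g, (g \in G) <-> reflection_group Rt g).
Implicit Types (a x y xi : 'cV[R]_n) (g h : 'M[R]_n) (t eta : R).

Local Notation osc := (osc E).
Local Notation sg := (@reflmx R n).

Definition mu x : R := \sum_(b <- Rp) dotp b x.

(** A scale-invariant form of [weyl_chamber_delta] in which the norm is replaced by [mu];
    the latter is linear, hence constant on the segments used for comparisons. *)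
Definition cone eta x : Prop :=
  0 < mu x /\ forall a, a \in Rp -> eta * mu x <= dotp a x.

Lemma muD x y : mu (x + y) = mu x + mu y.
Proof. by rewrite /mu -big_split; apply: eq_bigr => a _; rewrite dotpDr. Qed.

Lemma muZ (c : R) x : mu (c *: x) = c * mu x.
Proof. by rewrite /mu mulr_sumr; apply: eq_bigr => a _; rewrite dotpZr. Qed.

Lemma cone_scale eta (c : R) x : 0 < c -> cone eta x -> cone eta (c *: x).
Proof.
move=> c0 [x0 hx]; split=> [|a aP]; rewrite muZ; first exact: mulr_gt0.
by rewrite dotpZr mulrCA ler_pM2l// hx.
Qed.

Lemma cone_segment eta x0 x1 t : 0 <= t <= 1 -> cone eta x0 -> cone eta x1 ->
  mu x0 = mu x1 -> cone eta (x0 + t *: (x1 - x0)) /\ mu (x0 + t *: (x1 - x0)) = mu x0.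
Proof.
move=> /andP[t0 t1] [m0 h0] [m1 h1] e.
have em : mu (x0 + t *: (x1 - x0)) = mu x0.
  by rewrite muD muZ muD -scaleN1r muZ e mulN1r subrr mulr0 addr0.
split=> //; split=> [|a aP]; rewrite em//.
rewrite dotpDr dotpZr dotpDr dotpNr.
have -> : eta * mu x0 = (1 - t) * (eta * mu x0) + t * (eta * mu x1) by rewrite e; ring.
have -> : dotp a x0 + t * (dotp a x1 - dotp a x0) = (1 - t) * dotp a x0 + t * dotp a x1 by ring.
by rewrite lerD// ler_wpM2l ?subr_ge0// ?h0 ?h1.
Qed.

Section cone_fixed.
Variable eta : R.
Hypothesis eta0 : 0 < eta.

Lemma cone_pos x a : cone eta x -> a \in Rp -> 0 < dotp a x.
Proof. by move=> [m0 h] /h; apply: lt_le_trans; rewrite mulr_gt0. Qed.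

Lemma cone_le x a : cone eta x -> a \in Rp -> dotp a x <= mu x.
Proof.
move=> hx aP; rewrite /mu (big_rem _ aP)/= lerDl big_seq.
by apply: sumr_ge0 => b /mem_rem bP; exact/ltW/cone_pos.
Qed.

Lemma cone_root x a : cone eta x -> a \in Rt -> eta * mu x <= `|dotp a x|.
Proof.
move=> hx /(pos_or_neg hRt hRp) /orP[aP|aP].
  by rewrite ger0_norm ?(ltW (cone_pos hx aP))//; exact: hx.2.
rewrite -normrN -dotpNl ger0_norm ?(ltW (cone_pos hx aP))//; exact: hx.2.
Qed.

(** Square root of the weight on the open chamber. *)
Definition sqrtw x : R := expR (\sum_(a <- Rp) k a * ln (dotp a x)).

Definition amplitude g x y : R[i] :=
  (sqrtw x * sqrtw y)%:C * cexpi (- dotp x (g *m y)) * osc x (g *m y).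

(** [<coroot of a, g y>] *)
Definition freq g a y : R := 2 / dotp a a * dotp a (g *m y).

Definition wave g a x y : R[i] := cexpi (- (dotp a x * freq g a y)).

Definition coupling g a x xi y : R[i] :=
  (k a * dotp a xi / dotp a x)%:C * wave g a x y.

(** First-order primitive of [coupling]; the oscillation gains a factor
    [1 / (|x| |y|)] by integration by parts. *)
Definition corrector g a x y : R[i] :=
  'i%C * (k a / (freq g a y * dotp a x))%:C * wave g a x y.

Definition corrected g x y : R[i] :=
  amplitude g x y - \sum_(a <- Rp) corrector g a x y * amplitude (sg a *m g) x y.

Lemma pos_nz a : a \in Rp -> 0 < dotp a a.
Proof. by move=> /(pos_root hRp) /(root_nz hRt); exact: dotp_gt0. Qed.

(** Reflecting [x] amounts to reflecting [g y], at the cost of a phase. *)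
Lemma amplitude_refl g a x y : a \in Rp ->
  (sqrtw x * sqrtw y)%:C * cexpi (- dotp x (g *m y)) * osc (sg a *m x) (g *m y) =
  wave g a x y * amplitude (sg a *m g) x y.
Proof.
move=> aP; rewrite /amplitude.
have -> : osc (sg a *m x) (g *m y) = osc x (sg a *m g *m y).
  rewrite -(osc_group hRt hRp hk hE uG hG x _ (refl_pos_group hRp aP)).
  by rewrite !mulmxA reflmx_inv mul1mx.
rewrite -mulmxA reflE dotpDr dotpNr dotpZr -/(freq g a y).
rewrite /wave mulrA mulrCA -mulrA -cexpiD (dotpC x a).
by rewrite mulrA; congr (_ * cexpi _ * _); ring.
Qed.

Lemma is_derive_dotp a x xi t :
  is_derive t 1 (fun s => dotp a (x + s *: xi) : R^o) (dotp a xi).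
Proof.
have -> : (fun s => dotp a (x + s *: xi)) = (fun s => dotp a x + dotp a xi * s).
  by apply/funext => s; rewrite dotpDr dotpZr mulrC.
have h := is_derive_linear (dotp a xi) t.
apply: is_derive_eq (is_deriveD (is_derive_cst (dotp a x : R^o) t 1) h) _.
by rewrite add0r.
Qed.

Lemma is_derive_sqrtw x xi t : (forall a, a \in Rp -> 0 < dotp a (x + t *: xi)) ->
  is_derive t 1 (fun s => sqrtw (x + s *: xi) : R^o)
    (sqrtw (x + t *: xi) * \sum_(a <- Rp) k a * dotp a xi / dotp a (x + t *: xi)).
Proof.
move=> hx.
have h : is_derive t 1 (fun s => \sum_(a <- Rp) k a * ln (dotp a (x + s *: xi)) : R^o)
    (\sum_(a <- Rp) k a * dotp a xi / dotp a (x + t *: xi)).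
  apply: is_derive_sum_seq => a aP.
  have h1 := @is_derive1_comp _ (@ln R) (fun s => dotp a (x + s *: xi)) t _ _
    (is_derive1_ln (hx a aP)) (is_derive_dotp a x xi t).
  have h2 := @is_derive1_comp _ (fun z => k a * z) (fun s => ln (dotp a (x + s *: xi))) t _ _
    (is_derive_linear (k a) _) h1.
  by apply: is_derive_eq h2 _; ring.
exact: (@is_derive1_comp _ expR _ t _ _ (is_derive_expR _) h).
Qed.

(** The derivative of the weight cancels the diagonal reflection terms, that of the
    exponential cancels the eigenvalue; only the oscillating couplings remain. *)
Lemma cder_amplitude g x xi y t : g \in G ->
  (forall a, a \in Rp -> 0 < dotp a (x + t *: xi)) ->
  cder (fun s => amplitude g (x + s *: xi) y) t
    (\sum_(a <- Rp) coupling g a (x + t *: xi) xi y * amplitude (sg a *m g) (x + t *: xi) y).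
Proof.
move=> gG hx; set z := x + t *: xi.
have h1 : cder (fun s => (sqrtw (x + s *: xi) * sqrtw y)%:C) t
    (sqrtw z * (\sum_(a <- Rp) k a * dotp a xi / dotp a z) * sqrtw y)%:C.
  apply: cder_real; apply: is_derive_eq
    (is_deriveM (is_derive_sqrtw hx) (is_derive_cst (sqrtw y : R^o) t 1)) _.
  by rewrite /GRing.scale/= mulr0 add0r mulrC.
have h2 : cder (fun s => cexpi (- dotp (x + s *: xi) (g *m y))) t
    ('i%C * (- dotp xi (g *m y))%:C * cexpi (- dotp z (g *m y))).
  apply: (@cder_cexpi R (fun s => - dotp (x + s *: xi) (g *m y))).
  rewrite (dotpC xi); under eq_fun do rewrite dotpC.
  exact: (is_deriveN (is_derive_dotp (g *m y) x xi t)).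
have h3 := cder_osc hE (g *m y) (fun a aP => lt0r_neq0 (hx a aP)).
rewrite -/z in h3.
apply: cder_eq (cderM (cderM h1 h2) h3) _.
pose c a : R[i] := (k a * dotp a xi / dotp a z)%:C.
have -> : (sqrtw z * (\sum_(a <- Rp) k a * dotp a xi / dotp a z) * sqrtw y)%:C =
    (sqrtw z * sqrtw y)%:C * \sum_(a <- Rp) c a.
  by rewrite mulrAC rmorphM/=; congr (_ * _); rewrite rmorph_sum.
have -> : \sum_(a <- Rp) (k a * dotp a xi / dotp a z)%:C *
     (osc z (g *m y) - osc (sg a *m z) (g *m y)) =
   (\sum_(a <- Rp) c a) * osc z (g *m y) - \sum_(a <- Rp) c a * osc (sg a *m z) (g *m y).
  by rewrite mulr_suml -sumrB; apply: eq_bigr => a _; rewrite mulrBr.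
rewrite [RHS](_ : _ = (sqrtw z * sqrtw y)%:C * cexpi (- dotp z (g *m y)) *
   \sum_(a <- Rp) c a * osc (sg a *m z) (g *m y)); last first.
  rewrite mulr_sumr; apply: eq_big_seq => a aP.
  by rewrite [RHS]mulrCA amplitude_refl// /coupling -mulrA.
rewrite /phase rmorphN/=; ring.
Qed.

Lemma freq_ge g a y : g \in G -> a \in Rp -> cone eta y ->
  2 * eta * mu y / dotp a a <= `|freq g a y|.
Proof.
move=> /hG hg aP hy; rewrite /freq normrM ger0_norm ?divr_ge0 ?dotp_ge0//.
have -> : 2 * eta * mu y / dotp a a = 2 / dotp a a * (eta * mu y) by ring.
rewrite ler_wpM2l ?divr_ge0 ?dotp_ge0//.
have -> : dotp a (g *m y) = dotp (g^T *m a) y by rewrite dotp_mxl trmxK.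
apply: cone_root => //.
by have [_ _ _ h] := reflection_group_orth_stable hRt hg; apply: h; exact: (pos_root hRp).
Qed.

Lemma freq_gt0 g a y : g \in G -> a \in Rp -> cone eta y -> 0 < `|freq g a y|.
Proof.
move=> gG aP hy; apply: lt_le_trans (freq_ge gG aP hy).
by rewrite divr_gt0 ?pos_nz// !mulr_gt0//; exact: hy.1.
Qed.

Lemma cabs_wave g a x y : cabs (wave g a x y) = 1.
Proof. exact: cabs_cexpi. Qed.

Definition gam : R := \sum_(a <- Rp) k a.
Definition kap : R := \sum_(a <- Rp) k a * dotp a a / 2.

Lemma k_ge0 a : a \in Rp -> 0 <= k a.
Proof. by move=> aP; apply: (mult_ge0 hk); exact: (pos_root hRp). Qed.

Lemma gam_ge0 : 0 <= gam.
Proof. by rewrite /gam big_seq; apply: sumr_ge0 => a; exact: k_ge0. Qed.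

Lemma kap_ge0 : 0 <= kap.
Proof.
rewrite /kap big_seq; apply: sumr_ge0 => a aP.
by rewrite divr_ge0// mulr_ge0 ?dotp_ge0 ?k_ge0.
Qed.

Lemma cabs_corrector g a x y : g \in G -> a \in Rp -> cone eta x -> cone eta y ->
  cabs (corrector g a x y) <= k a * dotp a a / 2 / (eta ^+ 2 * (mu x * mu y)).
Proof.
move=> gG aP hx hy.
rewrite /corrector !cabsM cabs_i cabs_wave mul1r mulr1 cabs_real normrM normfV normrM.
rewrite (ger0_norm (k_ge0 aP)) (gtr0_norm (cone_pos hx aP)).
have x0 := hx.1; have y0 := hy.1; have aa := pos_nz aP.
have -> : k a * dotp a a / 2 / (eta ^+ 2 * (mu x * mu y)) =
    k a * (2 * eta * mu y / dotp a a * (eta * mu x))^-1.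
  by field; rewrite !gt_eqF.
rewrite ler_wpM2l ?k_ge0// lef_pV2 ?posrE.
- apply: ler_pM; [|by rewrite mulr_ge0 ?ltW|exact: freq_ge|exact: hx.2].
  by rewrite divr_ge0 ?dotp_ge0// !mulr_ge0// ltW.
- by rewrite mulr_gt0 ?freq_gt0 ?cone_pos.
- by rewrite !mulr_gt0// ?invr_gt0.
Qed.

Lemma cabs_coupling g a x xi y (lam : R) : a \in Rp -> cone eta x ->
  `|dotp a xi| <= lam * mu x -> cabs (coupling g a x xi y) <= k a * (lam / eta).
Proof.
move=> aP hx hxi; rewrite /coupling cabsM cabs_wave mulr1 cabs_real.
rewrite !normrM normfV (ger0_norm (k_ge0 aP)) (gtr0_norm (cone_pos hx aP)).
rewrite -mulrA ler_wpM2l ?k_ge0// ler_pdivrMr ?(cone_pos hx aP)//.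
apply: (le_trans hxi); have x0 := hx.1.
have lam0 : 0 <= lam by rewrite -(pmulr_lge0 _ x0); apply: le_trans hxi.
have -> : lam * mu x = lam / eta * (eta * mu x) by field; rewrite gt_eqF.
by rewrite ler_wpM2l ?divr_ge0 ?(ltW eta0)//; exact: hx.2.
Qed.

End cone_fixed.
End asymptotics.

(** * Asymptotic integration *)

Section corrected_estimates.
Variables (R : realType) (n : nat) (Rt Rp : {fset 'cV[R]_n}) (k : 'cV[R]_n -> R).
Variable E : 'cV[R[i]]_n -> 'cV[R[i]]_n -> R[i].
Hypotheses (hRt : reduced_root_system Rt) (hRp : positive_subsystem Rt Rp).
Hypotheses (hk : multiplicity Rt k) (hE : is_dunkl_kernel Rp k E).
Variable G : seq 'M[R]_n.
Hypotheses (uG : uniq G) (hG : forall g, (g \in G) <-> reflection_group Rt g).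
Variable eta : R.
Hypothesis eta0 : 0 < eta.
Implicit Types (a x y xi : 'cV[R]_n) (g h : 'M[R]_n) (t : R).

Local Notation osc := (osc E).
Local Notation sg := (@reflmx R n).
Local Notation mu := (mu Rp).
Local Notation cone := (cone Rp eta).
Local Notation amplitude := (amplitude Rp k E).
Local Notation corrected := (corrected Rp k E).
Local Notation gam := (gam Rp k).
Local Notation kap := (kap Rp k).

Definition l1_amplitude x y : R := \sum_(h <- G) cabs (amplitude h x y).

Lemma l1_amplitude_ge0 x y : 0 <= l1_amplitude x y.
Proof. by apply: sumr_ge0 => h _; exact: cabs_ge0. Qed.

Lemma le_l1_amplitude g x y : g \in G -> cabs (amplitude g x y) <= l1_amplitude x y.
Proof.
move=> gG; rewrite /l1_amplitude (big_rem _ gG)/= lerDl.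
by apply: sumr_ge0 => h _; exact: cabs_ge0.
Qed.

Lemma refl_group g a : g \in G -> a \in Rp -> sg a *m g \in G.
Proof. by move=> /hG gG aP; apply/hG; apply: RG_mul => //; exact: (refl_pos_group hRp). Qed.

Definition remainder g a x xi y : R :=
  k a * dotp a xi / (freq g a y * dotp a x ^+ 2).

Lemma cder_corrector g a x xi y t : g \in G -> a \in Rp ->
  cone (x + t *: xi) -> cone y ->
  cder (fun s => corrector k g a (x + s *: xi) y) t
    (coupling k g a (x + t *: xi) xi y -
     'i%C * (remainder g a (x + t *: xi) xi y)%:C * wave g a (x + t *: xi) y).
Proof.
move=> gG aP hz hy; set z := x + t *: xi; set th := freq g a y.
have az := cone_pos eta0 hz aP; have az0 : dotp a z != 0 by rewrite gt_eqF.
have th0 : th != 0 by rewrite -normr_gt0 (freq_gt0 hRt hRp hG eta0 gG aP hy).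
have dz := is_derive_dotp a x xi t.
have h1 : cder (fun s => (k a / (th * dotp a (x + s *: xi)))%:C) t
    (- remainder g a z xi y)%:C.
  apply: cder_real.
  have -> : (fun s => k a / (th * dotp a (x + s *: xi))) =
      (fun s => k a / th * (dotp a (x + s *: xi))^-1).
    by apply/funext => s; rewrite invfM mulrA.
  have dV := is_deriveV az0 dz.
  apply: is_derive_eq (is_deriveM (is_derive_cst (k a / th : R^o) t 1) dV) _.
  rewrite /GRing.scale/= mulr0 addr0 /remainder -/th -/z.
  by field; rewrite th0 az0.
have h2 : cder (fun s => wave g a (x + s *: xi) y) t
    ('i%C * (- (dotp a xi * th))%:C * wave g a z y).
  apply: (@cder_cexpi R (fun s => - (dotp a (x + s *: xi) * th))).
  apply: is_derive_eq (is_deriveN (is_deriveM dz (is_derive_cst (th : R^o) t 1))) _.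
  by rewrite /GRing.scale/= mulr0 add0r mulrC.
have h3 := cderM (cder_cst 'i%C t) (cderM h1 h2).
apply: cder_eq (cder_ext h3 _) _; first by move=> s; rewrite /corrector -/th !mulrA.
rewrite -/z mul0r add0r rmorphN/=.
have i2 : 'i%C * 'i%C = -1 :> R[i] by rewrite -expr2 sqr_i.
transitivity ('i%C * 'i%C * (k a / (th * dotp a z) * - (dotp a xi * th))%:C * wave g a z y -
  'i%C * (remainder g a z xi y)%:C * wave g a z y).
  by rewrite rmorphM/=; ring.
rewrite i2 /coupling; congr (_ - _); rewrite mulN1r -rmorphN/=.
by congr (_%:C * _); field; rewrite th0 az0.
Qed.

Lemma remainder_le g a x xi y (lam : R) : g \in G -> a \in Rp -> cone x -> cone y ->
  `|dotp a xi| <= lam * mu x ->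
  `|remainder g a x xi y| <= lam / (eta ^+ 3 * (mu x * mu y)) * (k a * dotp a a / 2).
Proof.
move=> gG aP hx hy hxi; rewrite /remainder !normrM normfV normrM normrX.
have ax := cone_pos eta0 hx aP.
rewrite (ger0_norm (k_ge0 hRp hk aP)) (gtr0_norm ax).
have x0 := hx.1; have y0 := hy.1; have aa := pos_nz hRt hRp aP.
have lam0 : 0 <= lam by rewrite -(pmulr_lge0 _ x0); apply: le_trans hxi.
have -> : lam / (eta ^+ 3 * (mu x * mu y)) * (k a * dotp a a / 2) =
  k a * (lam * mu x) * (2 * eta * mu y / dotp a a * (eta * mu x) ^+ 2)^-1.
  by field; rewrite !gt_eqF.
apply: ler_pM.
- by rewrite mulr_ge0 ?(k_ge0 hRp hk aP).
- by rewrite invr_ge0 mulr_ge0 ?sqr_ge0.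
- by rewrite ler_wpM2l ?(k_ge0 hRp hk aP).
- rewrite lef_pV2 ?posrE.
  + apply: ler_pM; [| |exact: (freq_ge hRt hRp hG eta0)|].
    * by rewrite divr_ge0 ?dotp_ge0// !mulr_ge0// ltW.
    * exact: sqr_ge0.
    * by rewrite lerXn2r ?nnegrE ?(ltW ax) ?mulr_ge0 ?(ltW eta0) ?(ltW x0)//; exact: hx.2.
  + by rewrite mulr_gt0 ?(freq_gt0 hRt hRp hG eta0)// exprn_gt0.
  + by rewrite !mulr_gt0// ?invr_gt0// ?exprn_gt0// mulr_gt0.
Qed.

Definition slope : R := kap / eta ^+ 3 * (1 + gam).

Lemma slope_ge0 : 0 <= slope.
Proof.
rewrite /slope mulr_ge0 ?divr_ge0 ?(kap_ge0 hRp hk)// ?exprn_ge0 ?(ltW eta0)//.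
by rewrite addr_ge0 ?(gam_ge0 hRp hk).
Qed.

(** The first-order terms of the amplitude equation and of the derivative of the
    corrector cancel; what is left is of second order in [1 / |x|]. *)
Lemma cder_corrected g x xi y t (lam : R) : g \in G -> 0 <= lam ->
  cone (x + t *: xi) -> cone y ->
  (forall a, a \in Rp -> `|dotp a xi| <= lam * mu (x + t *: xi)) ->
  exists2 D, cder (fun s => corrected g (x + s *: xi) y) t D &
    cabs D <= lam * slope / (mu (x + t *: xi) * mu y) * l1_amplitude (x + t *: xi) y.
Proof.
move=> gG lam0 hz hy hxi; set z := x + t *: xi.
have zpos a : a \in Rp -> 0 < dotp a (x + t *: xi) := fun aP => cone_pos eta0 hz aP.
have dF h (hinG : h \in G) := cder_amplitude hRt hRp hk hE uG hG y hinG zpos.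
rewrite -/z in dF.
pose r a : R[i] := 'i%C * (remainder g a z xi y)%:C * wave g a z y.
pose A a h := coupling k h a z xi y.
pose D := \sum_(a <- Rp) (r a * amplitude (sg a *m g) z y -
  corrector k g a z y * \sum_(c <- Rp) A c (sg a *m g) * amplitude (sg c *m (sg a *m g)) z y).
exists D.
  have h1 := dF g gG.
  have h2 : cder (fun s => \sum_(a <- Rp) corrector k g a (x + s *: xi) y *
      amplitude (sg a *m g) (x + s *: xi) y) t
    (\sum_(a <- Rp) ((A a g - r a) * amplitude (sg a *m g) z y + corrector k g a z y *
      \sum_(c <- Rp) A c (sg a *m g) * amplitude (sg c *m (sg a *m g)) z y)).
    apply: cder_sum => a aP; apply: cderM; first exact: cder_corrector.
    by apply: dF; exact: refl_group.
  apply: cder_eq (cderB h1 h2) _.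
  by rewrite -sumrB /D; apply: eq_bigr => a _; rewrite /A; ring.
have x0 := hz.1; have y0 := hy.1; rewrite -/z in x0.
have S0 := l1_amplitude_ge0 z y.
have p0 : 0 < mu z * mu y by rewrite mulr_gt0.
have Ab a h : a \in Rp -> cabs (A a h) <= k a * (lam / eta).
  by move=> aP; apply: (cabs_coupling hRp hk eta0); rewrite ?hxi.
have inner a : a \in Rp ->
    cabs (\sum_(c <- Rp) A c (sg a *m g) * amplitude (sg c *m (sg a *m g)) z y) <=
    gam * (lam / eta) * l1_amplitude z y.
  move=> aP; apply: (le_trans (cabs_sum _ _ _)); rewrite /gam !mulr_suml.
  rewrite big_seq [leRHS]big_seq; apply: ler_sum => c cP; rewrite cabsM.
  by rewrite ler_pM ?cabs_ge0 ?Ab// le_l1_amplitude// !refl_group.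
apply: (le_trans (cabs_sum _ _ _)).
have -> : lam * slope / (mu z * mu y) * l1_amplitude z y =
  \sum_(a <- Rp) k a * dotp a a / 2 *
    (lam / (eta ^+ 3 * (mu z * mu y)) * (1 + gam) * l1_amplitude z y).
  by rewrite -mulr_suml -/kap /slope; field; rewrite !gt_eqF.
rewrite big_seq [leRHS]big_seq; apply: ler_sum => a aP.
have kk0 : 0 <= k a * dotp a a / 2 by rewrite divr_ge0// mulr_ge0 ?dotp_ge0 ?(k_ge0 hRp hk).
have -> : k a * dotp a a / 2 * (lam / (eta ^+ 3 * (mu z * mu y)) * (1 + gam) * l1_amplitude z y) =
  lam / (eta ^+ 3 * (mu z * mu y)) * (k a * dotp a a / 2) * l1_amplitude z y +
  k a * dotp a a / 2 / (eta ^+ 2 * (mu z * mu y)) * (gam * (lam / eta) * l1_amplitude z y).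
  by field; rewrite !gt_eqF.
apply: (le_trans (cabsB _ _)); rewrite cabsM cabsM; apply: lerD.
- apply: ler_pM; rewrite ?cabs_ge0 ?le_l1_amplitude ?refl_group//.
  rewrite /r !cabsM cabs_i cabs_wave mul1r mulr1 cabs_real.
  by apply: remainder_le => //; exact: hxi.
- apply: ler_pM; rewrite ?cabs_ge0 ?inner//.
  exact: (cabs_corrector hRt hRp hk hG eta0).
Qed.

Lemma corrected_dist g x y : g \in G -> cone x -> cone y ->
  cabs (corrected g x y - amplitude g x y) <=
    kap / (eta ^+ 2 * (mu x * mu y)) * l1_amplitude x y.
Proof.
move=> gG hx hy; rewrite /corrected addrAC subrr add0r cabsN.
apply: (le_trans (cabs_sum _ _ _)); rewrite /kap 2!mulr_suml.
rewrite big_seq [leRHS]big_seq; apply: ler_sum => a aP; rewrite cabsM.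
apply: ler_pM; rewrite ?cabs_ge0 ?le_l1_amplitude ?refl_group//.
exact: (cabs_corrector hRt hRp hk hG eta0).
Qed.

Definition l1_corrected x y : R := \sum_(h <- G) cabs (corrected h x y).

(** Beyond this value of [mu x * mu y] the corrector is a contraction of norm 1/2. *)
Definition threshold : R := 1 + 2 * (size G)%:R * kap / eta ^+ 2.

Lemma threshold_ge1 : 1 <= threshold.
Proof.
by rewrite /threshold lerDl divr_ge0 ?exprn_ge0 ?(ltW eta0)// !mulr_ge0 ?(kap_ge0 hRp hk).
Qed.

Lemma l1_corrected_dist x y : cone x -> cone y -> threshold <= mu x * mu y ->
  \sum_(h <- G) cabs (corrected h x y - amplitude h x y) <= l1_amplitude x y / 2.
Proof.
move=> hx hy hp; have p0 : 0 < mu x * mu y by rewrite mulr_gt0 ?hx.1 ?hy.1.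
apply: (@le_trans _ _ (\sum_(h <- G) kap / (eta ^+ 2 * (mu x * mu y)) * l1_amplitude x y)).
  by rewrite big_seq [leRHS]big_seq; apply: ler_sum => h hinG; exact: corrected_dist.
rewrite sum_const_seq.
have -> : (size G)%:R * (kap / (eta ^+ 2 * (mu x * mu y)) * l1_amplitude x y) =
  (2 * (size G)%:R * kap / eta ^+ 2) / (mu x * mu y) * (l1_amplitude x y / 2).
  by field; rewrite !gt_eqF// ?hx.1 ?hy.1.
rewrite -[leRHS]mul1r ler_wpM2r ?divr_ge0 ?l1_amplitude_ge0// ler_pdivrMr// mul1r.
by apply: le_trans hp; rewrite /threshold lerDr.
Qed.

Lemma l1_amplitude_corrected x y : cone x -> cone y -> threshold <= mu x * mu y ->
  l1_amplitude x y <= 2 * l1_corrected x y /\ l1_corrected x y <= 2 * l1_amplitude x y.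
Proof.
move=> hx hy hp; have h := l1_corrected_dist hx hy hp.
have S0 := l1_amplitude_ge0 x y.
have h1 : l1_amplitude x y <= l1_corrected x y +
    \sum_(h <- G) cabs (corrected h x y - amplitude h x y).
  rewrite -big_split/=; apply: ler_sum => g _.
  by rewrite cabs_dist; apply: le_trans (cabsD _ _); rewrite addrC subrK.
have h2 : l1_corrected x y <= l1_amplitude x y +
    \sum_(h <- G) cabs (corrected h x y - amplitude h x y).
  rewrite -big_split/=; apply: ler_sum => g _.
  by apply: le_trans (cabsD _ _); rewrite addrC subrK.
by split; lra.
Qed.

Definition l2_corrected x y : R := \sum_(h <- G) cabs (corrected h x y) ^+ 2.

Lemma sum_sqr_le (I : Type) (s : seq I) (F : I -> R) :
  (\sum_(i <- s) F i) ^+ 2 <= (size s)%:R * \sum_(i <- s) F i ^+ 2.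
Proof.
have -> : (\sum_(i <- s) F i) ^+ 2 = \sum_(i <- s) \sum_(j <- s) F i * F j.
  by rewrite expr2 mulr_suml; apply: eq_bigr => i _; rewrite mulr_sumr.
have -> : (size s)%:R * \sum_(i <- s) F i ^+ 2 =
    \sum_(i <- s) \sum_(j <- s) (F i ^+ 2 + F j ^+ 2) / 2.
  transitivity (\sum_(i <- s) ((size s)%:R * (F i ^+ 2 / 2) + (\sum_(j <- s) F j ^+ 2) / 2)).
    rewrite big_split/= sum_const_seq -mulr_sumr -mulr_suml.
    by field.
  apply: eq_bigr => i _; rewrite -mulr_suml big_split/= mulrDl; congr (_ + _).
  by rewrite sum_const_seq mulrA.
apply: ler_sum => i _; apply: ler_sum => j _.
have := sqr_ge0 (F i - F j); lra.
Qed.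

Lemma l2_corrected_ge0 x y : 0 <= l2_corrected x y.
Proof. by apply: sumr_ge0 => h _; exact: sqr_ge0. Qed.

Lemma l2_corrected_le x y : l2_corrected x y <= l1_corrected x y ^+ 2.
Proof.
rewrite expr2 /l2_corrected {1}/l1_corrected mulr_suml big_seq [leRHS]big_seq.
apply: ler_sum => h hinG; rewrite expr2 ler_wpM2l ?cabs_ge0//.
rewrite /l1_corrected (big_rem _ hinG)/= lerDl.
by apply: sumr_ge0 => g _; exact: cabs_ge0.
Qed.

Definition growth : R := 4 * slope * (size G)%:R.

Lemma growth_ge0 : 0 <= growth.
Proof. by rewrite /growth mulr_ge0// mulr_ge0// slope_ge0. Qed.

(** Along a ray the corrected system is an integrable perturbation of a constant one,
    so its norm is trapped between fixed multiples of its initial value. *)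
Lemma l2_corrected_ray x y t : cone x -> cone y -> threshold <= mu x * mu y -> 1 <= t ->
  l2_corrected x y * expR (- growth) <= l2_corrected (t *: x) y <= l2_corrected x y * expR growth.
Proof.
move=> hx hy hp t1.
have hxs s : 1 <= s -> cone (0 + s *: x).
  by move=> s1; rewrite add0r; apply: cone_scale => //; exact: lt_le_trans s1.
have dZ g s : exists D, g \in G -> 1 <= s ->
    cder (fun s => corrected g (0 + s *: x) y) s D /\
    cabs D <= s^-1 * slope / (mu (0 + s *: x) * mu y) * l1_amplitude (0 + s *: x) y.
  have [gG|] := boolP (g \in G); last by exists 0.
  have [s1|] := leP 1 s; last by exists 0.
  have s0 : 0 < s := lt_le_trans ltr01 s1.
  have [| |D h1 h2] := @cder_corrected g 0 x y s s^-1 gG _ (hxs s s1) hy.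
  - by rewrite invr_ge0 ltW.
  - move=> a aP; rewrite add0r muZ mulrA mulVf ?gt_eqF// mul1r.
    by rewrite gtr0_norm ?(cone_pos eta0 hx)// (cone_le eta0 hx).
  by exists D.
have [D hD] := choice (fun gs : 'M[R]_n * R => dZ gs.1 gs.2).
pose dN s := \sum_(g <- G) 2 * rdot (corrected g (0 + s *: x) y) (D (g, s)).
have hN (s : R) : 1 <= s -> is_derive s 1 (fun s : R => l2_corrected (0 + s *: x) y : R^o) (dN s).
  move=> s1; apply: is_derive_sum_seq => g gG.
  exact: (is_derive_cabs_sqr (hD (g, s) gG s1).1).
have p1 : 1 <= mu x * mu y := le_trans threshold_ge1 hp.
have bN (s : R) : 1 <= s -> `|dN s| <= growth / s ^+ 2 * l2_corrected (0 + s *: x) y.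
  move=> s1; have s0 : 0 < s := lt_le_trans ltr01 s1.
  set z := 0 + s *: x; have hz : cone z by exact: hxs.
  have ez : mu z = s * mu x by rewrite /z add0r muZ.
  have [T1 _] : l1_amplitude z y <= 2 * l1_corrected z y /\ l1_corrected z y <= 2 * l1_amplitude z y.
    apply: l1_amplitude_corrected => //; rewrite ez -mulrA; apply: (le_trans hp).
    by rewrite ler_peMl// (le_trans ler01).
  have T0 : 0 <= l1_corrected z y by apply: sumr_ge0 => g _; exact: cabs_ge0.
  pose b := slope / (s ^+ 2 * (mu x * mu y)) * (2 * l1_corrected z y).
  have bD g : g \in G -> cabs (D (g, s)) <= b.
    move=> gG; apply: (le_trans (hD (g, s) gG s1).2); rewrite /= -/z ez /b.
    have -> : s^-1 * slope / (s * mu x * mu y) = slope / (s ^+ 2 * (mu x * mu y)).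
      by field; rewrite !gt_eqF// ?hx.1 ?hy.1.
    rewrite ler_wpM2l// divr_ge0 ?slope_ge0// mulr_ge0 ?sqr_ge0//.
    exact: le_trans p1.
  apply: (@le_trans _ _ (2 * b * l1_corrected z y)).
    rewrite /dN (le_trans (ler_norm_sum _ _ _))// /l1_corrected mulr_sumr.
    rewrite big_seq [leRHS]big_seq; apply: ler_sum => g gG.
    rewrite normrM ger0_norm// -mulrA ler_wpM2l// (le_trans (rdot_le_mul _ _))//.
    by rewrite mulrC ler_wpM2r ?cabs_ge0 ?bD.
  have -> : 2 * b * l1_corrected z y =
    4 * slope / s ^+ 2 / (mu x * mu y) * l1_corrected z y ^+ 2.
    by rewrite /b; field; rewrite !gt_eqF// ?hx.1 ?hy.1.
  have c0 : 0 <= 4 * slope / s ^+ 2.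
    by rewrite divr_ge0 ?sqr_ge0// mulr_ge0 ?slope_ge0.
  apply: (@le_trans _ _ (4 * slope / s ^+ 2 * ((size G)%:R * l2_corrected z y))); last first.
    by apply: eq_ler; rewrite /growth; ring.
  rewrite -[leLHS]mulrA ler_wpM2l//.
  apply: (@le_trans _ _ (l1_corrected z y ^+ 2)).
    by rewrite ler_piMl ?sqr_ge0// invf_le1// (lt_le_trans ltr01).
  exact: sum_sqr_le.
have := @gronwall_inv_sqr R (fun s => l2_corrected (0 + s *: x) y) dN growth t growth_ge0 t1.
rewrite scale1r !add0r; apply=> s /andP[s1 _]; [exact: hN|exact: l2_corrected_ge0|exact: bN].
Qed.

Definition base_bound : R :=
  (size G)%:R * (expR (gam * ln threshold) * (1 + (size G)%:R)).

(** At this level the weights contribute at most [threshold ^ gam], and the kernel is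
    bounded uniformly. *)
Lemma l1_amplitude_at_threshold x y : cone x -> cone y -> mu x * mu y = threshold ->
  l1_amplitude x y <= base_bound.
Proof.
move=> hx hy e; rewrite /base_bound -sum_const_seq /l1_amplitude.
rewrite big_seq [leRHS]big_seq; apply: ler_sum => g gG.
rewrite /amplitude !cabsM cabs_cexpi mulr1 cabs_real gtr0_norm ?mulr_gt0 ?expR_gt0//.
apply: ler_pM; rewrite ?cabs_ge0 ?mulr_ge0 ?expR_ge0//.
- rewrite /sqrtw -expRD ler_expR -big_split /gam mulr_suml/=.
  rewrite big_seq [leRHS]big_seq; apply: ler_sum => a aP.
  have ax := cone_pos eta0 hx aP; have ay := cone_pos eta0 hy aP.
  rewrite -mulrDr ler_wpM2l ?(k_ge0 hRp hk)// -lnM ?posrE// ler_ln ?posrE ?mulr_gt0//.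
    by rewrite -e ler_pM ?(ltW ax) ?(ltW ay)// (cone_le eta0).
  by rewrite (lt_le_trans ltr01)// threshold_ge1.
- have := osc_bounded hRp hk hE uG hG x (g *m y).
  set c := cabs _; have := sqr_ge0 (c - 1); have : 0 <= c := cabs_ge0 _.
  by nra.
Qed.

Definition amplitude_bound : R :=
  2 * ((size G)%:R * (expR growth * (2 * base_bound) ^+ 2)) + 2.

Lemma base_bound_ge0 : 0 <= base_bound.
Proof. by rewrite /base_bound !mulr_ge0 ?expR_ge0// addr_ge0. Qed.

Lemma amplitude_bound_ge0 : 0 <= amplitude_bound.
Proof. by rewrite /amplitude_bound addr_ge0// !mulr_ge0 ?expR_ge0 ?sqr_ge0. Qed.

(** Uniform boundedness, by descending along the ray to the level where the trivial
    bound on the kernel applies. *)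
Lemma l1_amplitude_bounded x y : cone x -> cone y -> threshold <= mu x * mu y ->
  l1_amplitude x y <= amplitude_bound.
Proof.
move=> hx hy hp; pose p := mu x * mu y; pose t := p / threshold.
have th0 : 0 < threshold := lt_le_trans ltr01 threshold_ge1.
have t1 : 1 <= t by rewrite /t ler_pdivlMr// mul1r.
have t0 : 0 < t := lt_le_trans ltr01 t1.
pose x1 := t^-1 *: x.
have hx1 : cone x1 by apply: cone_scale => //; rewrite invr_gt0.
have e1 : mu x1 * mu y = threshold.
  by rewrite /x1 muZ -mulrA -/p /t invf_div divfK// gt_eqF// /p mulr_gt0 ?hx.1 ?hy.1.
have ex : t *: x1 = x by rewrite /x1 scalerA mulfV ?gt_eqF// scale1r.
have le1 : threshold <= mu x1 * mu y by rewrite e1.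
have /andP[_] := l2_corrected_ray hx1 hy le1 t1; rewrite ex => hN.
have [hT _] := l1_amplitude_corrected hx hy hp.
have [_ hT1] := l1_amplitude_corrected hx1 hy le1.
have hB := l1_amplitude_at_threshold hx1 hy e1.
have hN1 : l2_corrected x1 y <= (2 * base_bound) ^+ 2.
  apply: (le_trans (l2_corrected_le _ _)); rewrite lerXn2r ?nnegrE ?mulr_ge0 ?base_bound_ge0//.
    by apply: sumr_ge0 => g _; exact: cabs_ge0.
  by apply: (le_trans hT1); rewrite ler_wpM2l.
have hsq : l1_corrected x y ^+ 2 <= (size G)%:R * (expR growth * (2 * base_bound) ^+ 2).
  apply: (le_trans (sum_sqr_le _ _)); rewrite ler_wpM2l// (le_trans hN)// mulrC.
  by rewrite ler_wpM2l ?expR_ge0.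
rewrite /amplitude_bound; apply: (le_trans hT).
have := sqr_ge0 (l1_corrected x y - 1); have := sqr_ge0 (l1_corrected x y); lra.
Qed.

(** The derivative along the ray is O(1 / t^2), so its integral up to infinity is of the
    order of the inverse of [mu x * mu y]. *)
Lemma corrected_ray_diff g x y t : g \in G -> cone x -> cone y ->
  threshold <= mu x * mu y -> 1 <= t ->
  cabs (corrected g (t *: x) y - corrected g x y) <=
    2 * (slope * amplitude_bound / (mu x * mu y)).
Proof.
move=> gG hx hy hp t1; set c := slope * amplitude_bound / (mu x * mu y).
have p0 : 0 < mu x * mu y by rewrite mulr_gt0 ?hx.1 ?hy.1.
have c0 : 0 <= c by rewrite divr_ge0 ?(ltW p0)// mulr_ge0 ?slope_ge0 ?amplitude_bound_ge0.
have hD (s : R) : exists D, 1 <= s -> cder (fun s => corrected g (0 + s *: x) y) s D /\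
    cabs D <= c / s ^+ 2.
  have [s1|] := leP 1 s; last by exists 0.
  have s0 : 0 < s := lt_le_trans ltr01 s1.
  have hxs : cone (0 + s *: x) by rewrite add0r; exact: cone_scale.
  have [| |D h1 h2] := @cder_corrected g 0 x y s s^-1 gG _ hxs hy.
  - by rewrite invr_ge0 ltW.
  - move=> a aP; rewrite add0r muZ mulrA mulVf ?gt_eqF// mul1r.
    by rewrite gtr0_norm ?(cone_pos eta0 hx)// (cone_le eta0 hx).
  exists D => _; split=> //; apply: (le_trans h2).
  have ez : mu (0 + s *: x) = s * mu x by rewrite add0r muZ.
  have -> : c / s ^+ 2 = s^-1 * slope / (mu (0 + s *: x) * mu y) * amplitude_bound.
    by rewrite ez /c; field; rewrite !gt_eqF// ?hx.1 ?hy.1.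
  rewrite ler_wpM2l//.
    by apply: divr_ge0; apply: mulr_ge0;
      rewrite ?invr_ge0 ?slope_ge0 ?(ltW s0) ?(ltW hxs.1) ?(ltW hy.1).
  apply: l1_amplitude_bounded => //; rewrite ez -mulrA (le_trans hp)//.
  by rewrite ler_peMl// ltW.
have [D {}hD] := choice hD.
have tt : 0 < t := lt_le_trans ltr01 t1.
have := @cder_bound_le R (fun s => corrected g (0 + s *: x) y) D
  (fun s => - c * s^-1) (fun s => c / s ^+ 2) 1 t t1.
rewrite scale1r !add0r invr1 mulr1 => H; apply: le_trans (H _ _ _) _.
- by move=> s /andP[s1 _]; exact: (hD s s1).1.
- move=> s /andP[s1 _]; have s0 : s != 0 by rewrite gt_eqF// (lt_le_trans ltr01).
  apply: is_derive_eq (@is_derive1_comp _ (fun z => - c * z) (fun s => s^-1) s _ _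
    (is_derive_linear (- c) _) (is_deriveV s0 (is_derive_id s (1 : R)))) _.
  by rewrite /GRing.scale/=; field.
- by move=> s /andP[/ltW s1 _]; exact: (hD s s1).2.
- by rewrite ler_wpM2l// mulNr opprK addrC gerDl oppr_le0 mulr_ge0// invr_ge0 ltW.
Qed.

Lemma corrected_segment_diff g x0 x1 y : g \in G -> cone x0 -> cone x1 -> cone y ->
  mu x0 = mu x1 -> threshold <= mu x0 * mu y ->
  cabs (corrected g x1 y - corrected g x0 y) <=
    2 * (slope * amplitude_bound / (mu x0 * mu y)).
Proof.
move=> gG h0 h1 hy e hp; set c := slope * amplitude_bound / (mu x0 * mu y).
have p0 : 0 < mu x0 * mu y by rewrite mulr_gt0 ?h0.1 ?hy.1.
have hD (s : R) : exists D, 0 <= s <= 1 ->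
    cder (fun s => corrected g (x0 + s *: (x1 - x0)) y) s D /\ cabs D <= c.
  have [s01|] := boolP (0 <= s <= 1); last by exists 0.
  have [hz ez] := cone_segment s01 h0 h1 e.
  have [a aP|D d1 d2] := @cder_corrected g x0 (x1 - x0) y s 1 gG ler01 hz hy.
  - rewrite ez mul1r dotpDr dotpNr.
    have a0 := cone_pos eta0 h0 aP; have a1 := cone_pos eta0 h1 aP.
    have b0 := cone_le eta0 h0 aP; have b1 := cone_le eta0 h1 aP.
    by rewrite ler_norml; apply/andP; split; lra.
  exists D => _; split=> //; apply: (le_trans d2); rewrite ez mul1r /c.
  rewrite (mulrAC slope amplitude_bound) ler_wpM2l ?divr_ge0 ?slope_ge0 ?(ltW p0)//.
  by apply: l1_amplitude_bounded => //; rewrite ez.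
have [D {}hD] := choice hD.
have := @cder_bound_le R (fun s => corrected g (x0 + s *: (x1 - x0)) y) D
  (fun s => c * s) (fun=> c) 0 1 ler01.
rewrite scale1r scale0r addr0 subrKC mulr1 mulr0 subr0; apply=> s hs.
- exact: (hD s hs).1.
- exact: is_derive_linear.
- by case/andP: hs => /ltW s0 /ltW s1; apply: (hD s _).2; rewrite s0.
Qed.

Definition rate : R := (4 * slope + 2 * (kap / eta ^+ 2)) * amplitude_bound.

Lemma rate_ge0 : 0 <= rate.
Proof.
apply: mulr_ge0; last exact: amplitude_bound_ge0.
apply: addr_ge0; apply: mulr_ge0 => //; first exact: slope_ge0.
by rewrite divr_ge0 ?sqr_ge0 ?(kap_ge0 hRp hk).
Qed.

(** The two points are joined by the ray from [x] up to the level of [x'] and then by a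
    segment of constant [mu]. *)
Lemma amplitude_dist_left g x x' y (P : R) : g \in G -> cone x -> cone x' -> cone y ->
  threshold <= P -> P <= mu x * mu y -> P <= mu x' * mu y ->
  cabs (amplitude g x' y - amplitude g x y) <= rate / P.
Proof.
move=> gG; wlog le : x x' / mu x <= mu x' => [H hx hx' hy hP p1 p2|].
  have [le|/ltW le] := leP (mu x) (mu x'); first exact: H.
  by rewrite cabs_dist; exact: H.
move=> hx hx' hy hP p1 p2.
have P0 : 0 < P by rewrite (lt_le_trans ltr01)// (le_trans threshold_ge1).
have hp1 := le_trans hP p1; have hp2 := le_trans hP p2.
have invP z : P <= z -> forall c, 0 <= c -> c / z <= c / P.
  by move=> hz c c0; rewrite ler_wpM2l// lef_pV2 ?posrE// (lt_le_trans P0).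
have sT : 0 <= slope * amplitude_bound by rewrite mulr_ge0 ?slope_ge0 ?amplitude_bound_ge0.
have kT : 0 <= kap / eta ^+ 2 * amplitude_bound.
  by rewrite mulr_ge0 ?amplitude_bound_ge0// divr_ge0 ?(kap_ge0 hRp hk) ?sqr_ge0.
pose c := mu x' / mu x; have x0 := hx.1.
have c1 : 1 <= c by rewrite /c ler_pdivlMr// mul1r.
have ec : mu (c *: x) = mu x' by rewrite muZ /c divfK// gt_eqF.
have hcx : cone (c *: x) by apply: cone_scale => //; exact: lt_le_trans c1.
have d1 : cabs (corrected g (c *: x) y - corrected g x y) <= 2 * (slope * amplitude_bound / P).
  by apply: (le_trans (corrected_ray_diff gG hx hy hp1 c1)); rewrite ler_wpM2l// invP.
have d2 : cabs (corrected g x' y - corrected g (c *: x) y) <= 2 * (slope * amplitude_bound / P).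
  apply: (le_trans (corrected_segment_diff gG hcx hx' hy ec _)); first by rewrite ec.
  by rewrite ler_wpM2l// ec invP.
have near z : cone z -> P <= mu z * mu y ->
    cabs (corrected g z y - amplitude g z y) <= kap / eta ^+ 2 * amplitude_bound / P.
  move=> hz pz; apply: (le_trans (corrected_dist gG hz hy)).
  apply: le_trans (invP _ pz _ kT).
  have -> : kap / (eta ^+ 2 * (mu z * mu y)) * l1_amplitude z y =
    kap / eta ^+ 2 * l1_amplitude z y / (mu z * mu y).
    by field; rewrite !gt_eqF// ?hz.1 ?hy.1.
  rewrite ler_wpM2r ?invr_ge0 ?(le_trans _ pz) ?(ltW P0)// ler_wpM2l//.
    by rewrite divr_ge0 ?(kap_ge0 hRp hk) ?sqr_ge0.
  by apply: l1_amplitude_bounded => //; exact: le_trans pz.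
have n1 := near x hx p1; have n2 := near x' hx' p2.
have -> : amplitude g x' y - amplitude g x y =
  (corrected g x' y - corrected g (c *: x) y) + (corrected g (c *: x) y - corrected g x y) +
  (corrected g x y - amplitude g x y) - (corrected g x' y - amplitude g x' y) by ring.
apply: (le_trans (cabsB _ _)); apply: (le_trans (lerD (cabsD _ _) n2)).
have := cabsD (corrected g x' y - corrected g (c *: x) y) (corrected g (c *: x) y - corrected g x y).
have -> : rate / P = 4 * (slope * amplitude_bound / P) + 2 * (kap / eta ^+ 2 * amplitude_bound / P).
  by rewrite /rate; field; rewrite !gt_eqF.
lra.
Qed.

Lemma amplitude_sym g x y : g \in G -> amplitude g x y = amplitude g^T y x.
Proof.
move=> /hG hg; have [g1 g2 _ _] := reflection_group_orth_stable hRt hg.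
have hgt := reflection_group_tr hRt hg.
rewrite /amplitude mulrC [RHS]mulrC (mulrC (sqrtw Rp k x)); congr (_ * (_ * cexpi (- _))).
- rewrite -(osc_group hRt hRp hk hE uG hG x (g *m y) hgt) mulmxA g1 mul1mx.
  by rewrite (osc_sym hRt hRp hk hE uG hG).
- by rewrite (dotpC y) dotp_mxl trmxK.
Qed.

Lemma amplitude_scale g x y (c : R) : 0 < c -> cone x -> cone y ->
  amplitude g (c *: x) y = amplitude g x (c *: y).
Proof.
move=> c0 hx hy; rewrite /amplitude -!scalemxAr.
rewrite (osc_scale hRp hk hE uG hG) dotpZl dotpZr; congr (_%:C * _ * _).
rewrite /sqrtw -!expRD -!big_split/=; congr expR; apply: eq_big_seq => a aP.
have ax := cone_pos eta0 hx aP; have ay := cone_pos eta0 hy aP.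
by rewrite !dotpZr !lnM ?posrE//; ring.
Qed.

(** Only the product [mu x * mu y] matters by scaling, and the two arguments play the same
    role by symmetry; so after normalising [mu y] to 1 one moves first [x], then [y]. *)
Lemma amplitude_dist g x y x' y' (P : R) : g \in G ->
  cone x -> cone y -> cone x' -> cone y' ->
  threshold <= P -> P <= mu x * mu y -> P <= mu x' * mu y' ->
  cabs (amplitude g x' y' - amplitude g x y) <= 2 * (rate / P).
Proof.
move=> gG hx hy hx' hy' hP p1 p2.
have normalise z w : cone z -> cone w -> exists z' w', [/\ cone z', cone w',
    mu z' = mu z * mu w, mu w' = 1 & amplitude g z w = amplitude g z' w'].
  move=> hz hw; have w0 := hw.1.
  exists (mu w *: z), ((mu w)^-1 *: w); split.
  - exact: cone_scale.
  - by apply: cone_scale => //; rewrite invr_gt0.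
  - by rewrite muZ mulrC.
  - by rewrite muZ mulVf ?gt_eqF.
  - have hw' : cone ((mu w)^-1 *: w) by apply: cone_scale => //; rewrite invr_gt0.
    by rewrite (amplitude_scale _ w0 hz hw') scalerA mulfV ?gt_eqF// scale1r.
have [X [Y [hX hY eX eY ->]]] := normalise _ _ hx hy.
have [X' [Y' [hX' hY' eX' eY' ->]]] := normalise _ _ hx' hy'.
have gtG : g^T \in G by apply/hG; apply: (reflection_group_tr hRt); exact/hG.
have d1 : cabs (amplitude g X' Y - amplitude g X Y) <= rate / P.
  by apply: amplitude_dist_left => //; rewrite ?eX ?eX' eY mulr1.
have d2 : cabs (amplitude g X' Y' - amplitude g X' Y) <= rate / P.
  rewrite !(amplitude_sym _ _ gG).
  by apply: amplitude_dist_left => //; rewrite ?eY ?eY' eX' mul1r.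
rewrite -(subrK (amplitude g X' Y) (amplitude g X' Y')) -addrA.
apply: (le_trans (cabsD _ _)); lra.
Qed.

(** The values of the kernel on an orbit do not vanish simultaneously, and the norm of the
    corrected system keeps this property along the ray. *)
Lemma l1_amplitude_lower x y : cone x -> cone y -> threshold <= mu x * mu y ->
  exists2 c : R, 0 < c & forall t, 1 <= t -> c <= l1_amplitude (t *: x) y.
Proof.
move=> hx hy hp; have tot0 : 0 < l1_amplitude x y.
  rewrite ltNge; apply/negP => h.
  have := osc_orbit_pos hRt hRp hk hE uG hG x y; rewrite big_seq big1 ?ltxx// => g gG.
  have : cabs (amplitude g x y) = 0.
    by apply/le_anti; rewrite cabs_ge0 (le_trans (le_l1_amplitude x y gG)).
  rewrite /amplitude !cabsM cabs_cexpi mulr1 cabs_real => /eqP.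
  rewrite mulf_eq0 normr_eq0 gt_eqF ?mulr_gt0 ?expR_gt0//= => /eqP ->.
  by rewrite expr0n.
have N0 : 0 < l2_corrected x y.
  have [h _] := l1_amplitude_corrected hx hy hp.
  have T0 : 0 < l1_corrected x y by lra.
  have := sum_sqr_le G (fun h => cabs (corrected h x y)).
  rewrite -/(l1_corrected x y) -/(l2_corrected x y) => h2.
  have := lt_le_trans (exprn_gt0 2 T0) h2.
  by rewrite pmulr_rgt0// ltr0n; have := one_in_group hG; case: (G).
pose q := l2_corrected x y * expR (- growth).
have q0 : 0 < q by rewrite mulr_gt0 ?expR_gt0.
exists (Num.min 1 q / 2) => [|t t1]; first by rewrite divr_gt0// lt_min ltr01.
have t0 : 0 < t := lt_le_trans ltr01 t1.
have /andP[h1 _] := l2_corrected_ray hx hy hp t1.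
have hpt : threshold <= mu (t *: x) * mu y.
  by rewrite muZ -mulrA (le_trans hp)// ler_peMl// mulr_ge0 ?(ltW hx.1) ?(ltW hy.1).
have [_ h2] := l1_amplitude_corrected (cone_scale t0 hx) hy hpt.
have h3 := le_trans h1 (l2_corrected_le _ _); rewrite -/q in h3.
rewrite ler_pdivrMr// mulrC; apply: le_trans h2.
set T := l1_corrected _ _ in h3 *.
have T0 : 0 <= T by apply: sumr_ge0 => g _; exact: cabs_ge0.
have [T1|T1] := leP 1 T; first by rewrite ge_min T1.
rewrite ge_min; apply/orP; right; apply: (le_trans h3).
by rewrite expr2 ler_piMr// ltW.
Qed.

End corrected_estimates.

(** * Limits *)

Section limits.
Variable R : realType.

Lemma cauchy_real_lim (u : nat -> R) :
  (forall e : R, 0 < e -> exists N, forall m, (N <= m)%N -> `|u m - u N| < e) ->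
  exists l, forall e : R, 0 < e -> exists N, forall m, (N <= m)%N -> `|u m - l| < e.
Proof.
move=> hu; have /cauchy_cvg/cvg_ex[l hl] : cauchy ((u : nat -> R^o) @ \oo).
  apply: cauchy_exP => e e0; have [N hN] := hu e e0; exists (u N).
  by exists N => // m /= Nm; rewrite /ball/= distrC; exact: hN.
exists l => e e0; move/cvgrPdist_lt/(_ e e0) : hl => [N _ hN].
by exists N => m Nm; rewrite distrC; exact: hN.
Qed.

Lemma cauchy_complex_lim (u : nat -> R[i]) :
  (forall e : R, 0 < e -> exists N, forall m, (N <= m)%N -> cabs (u m - u N) < e) ->
  exists l, forall e : R, 0 < e -> exists N, forall m, (N <= m)%N -> cabs (u m - l) < e.
Proof.
move=> hu.
have [|l1 h1] := @cauchy_real_lim (fun m => complex.Re (u m)).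
  move=> e /hu[N hN]; exists N => m /hN; apply: le_lt_trans.
  by rewrite -RecN -RecD normRe_cabs.
have [|l2 h2] := @cauchy_real_lim (fun m => complex.Im (u m)).
  move=> e /hu[N hN]; exists N => m /hN; apply: le_lt_trans.
  by rewrite -ImcN -ImcD normIm_cabs.
exists (l1 +i* l2) => e e0; have e2 : 0 < e / 2 by lra.
have [N1 hN1] := h1 _ e2; have [N2 hN2] := h2 _ e2.
exists (maxn N1 N2) => m; rewrite geq_max => /andP[/hN1 k1 /hN2 k2].
apply: (le_lt_trans (cabs_ReIm _)); rewrite RecD RecN ImcD ImcN /=; lra.
Qed.

End limits.

Section chamber.
Variables (R : realType) (n : nat) (Rp : {fset 'cV[R]_n}).
Implicit Types (a x : 'cV[R]_n).

Lemma cone_mono (eta eta' : R) x : eta' <= eta -> cone Rp eta x -> cone Rp eta' x.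
Proof.
move=> le [x0 hx]; split=> // a aP; apply: le_trans (hx a aP).
by rewrite ler_wpM2r// ltW.
Qed.

Lemma mu_gt0 x a : a \in Rp -> (forall b, b \in Rp -> 0 < dotp b x) -> 0 < mu Rp x.
Proof.
move=> aP hx; rewrite /mu (big_rem _ aP)/= ltr_pwDl ?hx// big_seq.
by apply: sumr_ge0 => b /mem_rem /hx /ltW.
Qed.

Lemma cone_of_pos x a : a \in Rp -> (forall b, b \in Rp -> 0 < dotp b x) ->
  exists2 eta : R, 0 < eta & cone Rp eta x.
Proof.
move=> aP hx; have m0 := mu_gt0 aP hx.
pose s := \sum_(b <- Rp) mu Rp x / dotp b x.
have hs b : b \in Rp -> mu Rp x / dotp b x <= s.
  move=> bP; rewrite /s (big_rem _ bP)/= lerDl big_seq.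
  by apply: sumr_ge0 => c /mem_rem /hx c0; rewrite divr_ge0 ?ltW.
have s0 : 0 < s by apply: lt_le_trans (hs _ aP); rewrite divr_gt0 ?hx.
exists s^-1; first by rewrite invr_gt0.
split=> // b bP; rewrite mulrC ler_pdivrMr// mulrC -ler_pdivrMr ?hx//.
exact: hs.
Qed.

Lemma cone_of_chamber_delta (delta : R) a : a \in Rp -> 0 < delta -> a != 0 ->
  exists2 eta : R, 0 < eta & forall x, weyl_chamber_delta Rp delta x ->
    cone Rp eta x /\ delta * enorm x <= mu Rp x.
Proof.
move=> aP d0 a0; pose A := \sum_(b <- Rp) enorm b.
have A0 : 0 < A.
  rewrite /A (big_rem _ aP)/= ltr_pwDl// ?sqrtr_gt0 ?dotp_gt0//.
  by apply: sumr_ge0 => b _; exact: enorm_ge0.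
exists (delta / A) => [|x [wx dx]]; first by rewrite divr_gt0.
have hx b : b \in Rp -> 0 < dotp b x by move=> bP; rewrite dotpC; exact: wx.
have m0 := mu_gt0 aP hx.
have mA : mu Rp x <= A * enorm x.
  by rewrite /mu /A mulr_suml; apply: ler_sum => b _; exact: dotp_le_enorm.
split; [split=> // b bP|].
  apply: (@le_trans _ _ (delta / A * (A * enorm x))).
    by rewrite ler_wpM2l// divr_ge0 ?ltW.
  by rewrite mulrA divfK ?gt_eqF// dotpC dx.
apply: (le_trans (dx a aP)); rewrite dotpC /mu (big_rem _ aP)/= lerDl big_seq.
by apply: sumr_ge0 => b /mem_rem /hx /ltW.
Qed.

Lemma sqrtw_weight (k : 'cV[R]_n -> R) x : (forall b, b \in Rp -> 0 < dotp b x) ->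
  dunkl_weight Rp k x = sqrtw Rp k x ^+ 2.
Proof.
move=> hx; rewrite /sqrtw -expRM_natl mulr_sumr expR_sum /dunkl_weight.
apply: eq_big_seq => a aP; rewrite /powR gtr0_norm ?hx// gt_eqF ?hx//.
by rewrite mulrA.
Qed.

End chamber.

Theorem theorem2p6 (R : realType) (n : nat) (Rt Rp : {fset 'cV[R]_n})
    (k : 'cV[R]_n -> R) (E : 'cV[R[i]]_n -> 'cV[R[i]]_n -> R[i])
    (hRt : reduced_root_system Rt) (hRp : positive_subsystem Rt Rp)
    (hk : multiplicity Rt k) (hgamma : 0 < \sum_(a <- Rp) k a)
    (hE : is_dunkl_kernel Rp k E) :
  exists v : 'M[R]_n -> R[i],
    (exists2 g, reflection_group Rt g & v g != 0) /\
    forall (delta : R) (g : 'M[R]_n), 0 < delta -> reflection_group Rt g ->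
    forall eps : R, 0 < eps -> exists2 M : R, 0 < M &
      forall x y : 'cV[R]_n,
        weyl_chamber_delta Rp delta x -> weyl_chamber_delta Rp delta y ->
        M <= enorm x * enorm y ->
        `|(Num.sqrt (dunkl_weight Rp k x * dunkl_weight Rp k y))%:C *
            cexpi (- dotp x (g *m y)) * E ('i%C *: toC x) (toC (g *m y)) - v g|
          < eps%:C.
Proof.
have [G uG hG] := reflection_group_finite hRt.
have [a aP] : exists a, a \in Rp.
  case: (fset_0Vmem Rp) => [e|[a aP]]; last by exists a.
  by move: hgamma; rewrite e big_seq_fset0 ltxx.
have a0 := root_nz hRt (pos_root hRp aP).
have [b hb] : exists b, forall c, c \in Rp -> 0 < dotp c b.
  by case: (hRp) => b _ h; exists b => c; rewrite h => /andP[].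
have [etab etab0 cb] := cone_of_pos aP hb.
have m0 := mu_gt0 aP hb.
pose amp := amplitude Rp k E.
pose u g m := amp g (m.+1%:R *: b) b.
have cbm m eta : cone Rp eta b -> cone Rp eta (m.+1%:R *: b).
  by move=> h; apply: cone_scale => //; rewrite ltr0n.
have level (P : R) : exists N, forall m, (N <= m)%N -> P <= mu Rp (m.+1%:R *: b) * mu Rp b.
  have mm0 : 0 < mu Rp b * mu Rp b by rewrite mulr_gt0.
  exists (Num.bound (`|P| / (mu Rp b * mu Rp b))) => m Nm.
  have h : 0 <= `|P| / (mu Rp b * mu Rp b) by rewrite divr_ge0// ltW.
  rewrite muZ -mulrA -ler_pdivrMr//; apply: (@le_trans _ _ (`|P| / (mu Rp b * mu Rp b))).
    by rewrite ler_wpM2r ?invr_ge0 ?(ltW mm0)// ler_norm.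
  by apply: (le_trans (ltW (archi_boundP h))); rewrite ler_nat leqW.
have close (eta e : R) : 0 < eta -> 0 < e -> exists2 P : R, 1 <= P & threshold Rp k G eta <= P /\
    forall g x y x' y', g \in G -> cone Rp eta x -> cone Rp eta y ->
      cone Rp eta x' -> cone Rp eta y' -> P <= mu Rp x * mu Rp y ->
      P <= mu Rp x' * mu Rp y' -> cabs (amp g x' y' - amp g x y) <= e.
  move=> eta0 e0; pose c := 2 * rate Rp k G eta.
  have th1 := threshold_ge1 hRp hk G eta0.
  have c0 : 0 <= c by rewrite mulr_ge0// (rate_ge0 hRp hk).
  have ce : 0 <= c / e by rewrite divr_ge0// ltW.
  exists (threshold Rp k G eta + c / e); first by rewrite (le_trans th1)// lerDl.
  split=> [|g x y x' y' gG hx hy hx' hy' p1 p2]; first by rewrite lerDl.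
  have P0 : 0 < threshold Rp k G eta + c / e by rewrite (lt_le_trans ltr01)// (le_trans th1)// lerDl.
  apply: (le_trans (amplitude_dist hRt hRp hk hE uG hG eta0 gG hx hy hx' hy' _ p1 p2)).
    by rewrite lerDl.
  rewrite mulrA -/c ler_pdivrMr// mulrDr [X in _ + X]mulrC divfK ?gt_eqF//.
  by rewrite lerDr mulr_ge0 ?(ltW e0)// (le_trans ler01 th1).
have lim g : exists l, g \in G ->
    forall e : R, 0 < e -> exists N, forall m, (N <= m)%N -> cabs (u g m - l) < e.
  have [gG|] := boolP (g \in G); last by exists 0.
  have [|l hl] := @cauchy_complex_lim R (u g); last by exists l.
  move=> e e0; have e2 : 0 < e / 2 by lra.
  have [P P1 [_ hP]] := close etab _ etab0 e2; have [N hN] := level P.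
  exists N => m Nm; apply: (@le_lt_trans _ _ (e / 2)); last by lra.
  by apply: hP => //; rewrite ?hN//; exact: cbm.
have [v hv] := choice lim.
exists v; split.
  apply: contrapT => no.
  have v0 g : g \in G -> v g = 0.
    move=> gG; apply/eqP; rewrite -[_ == _]negbK; apply/negP => vg; apply: no.
    by exists g => //; exact/hG.
  have [N hN] := level (threshold Rp k G etab).
  have [c c0 hc] := l1_amplitude_lower hRt hRp hk hE uG hG etab0 (cbm N _ cb) cb (hN N (leqnn N)).
  pose e := c / (2 * (size G)%:R).
  have sG : 0 < (size G)%:R :> R by rewrite ltr0n; have := one_in_group hG; case: (G).
  have e0 : 0 < e by rewrite divr_gt0// mulr_gt0.
  have hN' g : exists N', g \in G -> forall m, (N' <= m)%N -> cabs (u g m) < e.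
    have [gG|] := boolP (g \in G); last by exists 0%N.
    have [N' h'] := hv g gG e e0; exists N' => _ m /h'.
    by rewrite v0// subr0.
  have [Nf hNf] := choice hN'.
  pose m := (N + \sum_(g <- G) Nf g)%N.
  have tot : l1_amplitude Rp k E G (m.+1%:R *: b) b <= c / 2.
    rewrite (_ : c / 2 = (size G)%:R * e); last by rewrite /e; field; rewrite gt_eqF.
    rewrite -sum_const_seq /l1_amplitude big_seq [leRHS]big_seq; apply: ler_sum => g gG.
    apply/ltW; apply: (hNf g gG); rewrite /m (big_rem _ gG)/=.
    by rewrite addnCA leq_addr.
  have := hc (m.+1%:R / N.+1%:R).
  rewrite scalerA divfK ?pnatr_eq0// ler_pdivlMr ?ltr0n// mul1r ler_nat ltnS leq_addr.
  by move=> /(_ isT) h; lra.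
move=> delta g delta0 /hG gG eps eps0.
have [etad etad0 hd] := cone_of_chamber_delta aP delta0 a0.
(* A single cone must contain both the chamber points and the ray of b that defines v. *)
pose eta := Num.min etad etab.
have eta0 : 0 < eta by rewrite lt_min etad0.
have cb' : cone Rp eta b by apply: cone_mono cb; rewrite ge_min lexx orbT.
have e4 : 0 < eps / 4 by lra.
have [P P1 [_ hP]] := close eta _ eta0 e4.
have P0 : 0 < P := lt_le_trans ltr01 P1.
exists (P / delta ^+ 2) => [|x y dx dy hM]; first by rewrite divr_gt0// exprn_gt0.
have [cx mx] := hd x dx; have [cy my] := hd y dy.
have cx' : cone Rp eta x by apply: cone_mono cx; rewrite ge_min lexx.
have cy' : cone Rp eta y by apply: cone_mono cy; rewrite ge_min lexx.
have pxy : P <= mu Rp x * mu Rp y.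
  apply: (@le_trans _ _ ((delta * enorm x) * (delta * enorm y))).
    move: hM; rewrite ler_pdivrMr ?exprn_gt0// => /le_trans; apply.
    by apply: eq_ler; ring.
  by rewrite ler_pM// mulr_ge0 ?enorm_ge0// ltW.
have posd z c : weyl_chamber_delta Rp delta z -> c \in Rp -> 0 < dotp c z.
  by move=> [wz _] cP; rewrite dotpC; exact: wz.
rewrite ltc_cabs.
have -> : (Num.sqrt (dunkl_weight Rp k x * dunkl_weight Rp k y))%:C *
    cexpi (- dotp x (g *m y)) * E ('i%C *: toC x) (toC (g *m y)) = amp g x y.
  rewrite (kernel_osc hRp hk hE uG hG) /amp /amplitude; congr (_%:C * _ * _).
  rewrite !sqrtw_weight => [|c cP|c cP]; try exact: posd.
  by rewrite -exprMn sqrtr_sqr gtr0_norm// mulr_gt0 ?expR_gt0.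
have [N1 hN1] := hv g gG _ e4; have [N2 hN2] := level P.
pose m := maxn N1 N2.
have d1 := hN1 m (leq_maxl _ _).
have d2 : cabs (amp g x y - u g m) <= eps / 4.
  apply: hP => //; first exact: cbm.
  by apply: hN2; exact: leq_maxr.
rewrite -(subrK (u g m) (amp g x y)) -addrA.
apply: (le_lt_trans (cabsD _ _)); lra.
Qed.
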